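(* Let $\alpha\in[0,1/6]\cup\{1/2\}$ and let $f\in\mathcal{S}^{*}(\alpha)$, with Taylor expansion $f(z)=z+\sum_{n=2}^{\infty}a_nz^n$. Then $$|H_3(1)|\leq \frac{4(1-\alpha)^2}{9},$$ where $H_3(1)$ is the third Hankel determinant of $f$. The result is sharp, i.e. for each such $\alpha$ there is a function $f\in\mathcal{S}^{*}(\alpha)$ for which equality holds.
   Context: Let $\mathbb{D}=\{z\in\mathbb{C}:|z|<1\}$, and let $\mathcal{A}$ be the set of analytic functions $f$ on $\mathbb{D}$ of the form $f(z)=z+\sum_{n=2}^{\infty}a_nz^n$ (complex coefficients $a_n$). For $0\leq\alpha<1$, a function $f\in\mathcal{A}$ is starlike of order $\alpha$ if $\operatorname{Re}\left(\frac{zf'(z)}{f(z)}\right)>\alpha$ for all $z\in\mathbb{D}$ (the quotient $zf'(z)/f(z)$ takes the value $1$ at $z=0$, by removing the singularity, and $f(z)\neq 0$ for $z\in\mathbb{D}\setminus\{0\}$). The class of all such functions is denoted $\mathcal{S}^{*}(\alpha)$. The third Hankel determinant of $f\in\mathcal{A}$ is (with $a_1:=1$) $$H_3(1)=\begin{vmatrix} 1 & a_2 & a_3 \\ a_2 & a_3 & a_4 \\ a_3 & a_4 & a_5 \end{vmatrix}=a_3(a_2a_4-a_3^2)-a_4(a_4-a_2a_3)+a_5(a_3-a_2^2).$$ *)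

(* Defs.v *)
From Stdlib Require Import Reals.
From Coquelicot Require Import Coquelicot.
Open Scope R_scope.

(* Functions on the open unit disc are represented by total functions [C -> C];
   every definition below only depends on the values taken inside the disc. *)
Definition in_disc (z : C) : Prop := Cmod z < 1.

Definition analytic_on_disc (f : C -> C) : Prop :=
  forall z : C, in_disc z -> ex_derive (K := C_AbsRing) (V := C_NormedModule) f z.

(* f(z) = z + a_2 z^2 + a_3 z^3 + ... throughout the disc *)
Definition normalized_expansion (f : C -> C) (a : nat -> C) : Prop :=
  a 0%nat = RtoC 0 /\ a 1%nat = RtoC 1 /\
  forall z : C, in_disc z ->
    is_pseries (K := C_AbsRing) (V := C_NormedModule) a z (f z).

Definition class_A (f : C -> C) : Prop :=
  analytic_on_disc f /\ exists a : nat -> C, normalized_expansion f a.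

(* z f'(z) / f(z), with the removable singularity at 0 filled in *)
Definition starlike_quotient (f : C -> C) (z : C) : C :=
  if Ceq_dec z (RtoC 0) then RtoC 1 else (z * C_derive f z / f z)%C.

(* Division by 0 is total in Coquelicot, so the zero-freeness that makes the
   quotient meaningful is stated explicitly. *)
Definition starlike (alpha : R) (f : C -> C) : Prop :=
  class_A f /\
  (forall z : C, in_disc z -> z <> RtoC 0 -> f z <> RtoC 0) /\
  (forall z : C, in_disc z -> alpha < Re (starlike_quotient f z)).

Definition det3 (x11 x12 x13 x21 x22 x23 x31 x32 x33 : C) : C :=
  (x11 * (x22 * x33 - x23 * x32)
   - x12 * (x21 * x33 - x23 * x31)
   + x13 * (x21 * x32 - x22 * x31))%C.

Definition hankel3 (a : nat -> C) : C :=
  det3 (RtoC 1)  (a 2%nat) (a 3%nat)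
       (a 2%nat) (a 3%nat) (a 4%nat)
       (a 3%nat) (a 4%nat) (a 5%nat).

Lemma hankel3E (a : nat -> C) :
  hankel3 a =
  (a 3%nat * (a 2%nat * a 4%nat - a 3%nat * a 3%nat)
   - a 4%nat * (a 4%nat - a 2%nat * a 3%nat)
   + a 5%nat * (a 3%nat - a 2%nat * a 2%nat))%C.
Proof. unfold hankel3, det3; ring. Qed.

(* Main.v *)
Require Import Defs.
From Stdlib Require Import Reals Lra Psatz.
From Coquelicot Require Import Coquelicot.
Open Scope R_scope.

(* Put [beta = 1 - alpha], [g = f / z] and [omega = g' / (2 beta g + z g')]. Since
   [z f' / f = 1 + z g' / g], starlikeness of order [alpha] says that [|z omega(z)| <= 1] in the disc.
   Integrating [|omega p - q|^2 >= 0] over circles, for cubic polynomials [p] and the Taylor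
   polynomial [q] of [omega p], shows that the lower triangular Toeplitz matrix of the first four
   Taylor coefficients of [omega] is a contraction; the means are computed by letting the radius
   tend to 0. One Schur step and Carlson's inequality then give the parametrisation
     [b1 = u e0], [b2 = u (e1 - conj c e0^2)], [b3 = u (e2 - 2 conj c e0 e1 + conj c^2 e0^3)],
     [c = b0], [u = 1 - |c|^2],
     [|e0| <= 1], [|e1| <= 1 - |e0|^2], [|e2| <= 1 - |e0|^2 - |e1|^2 / (1 + |e0|)].
   In these variables the Hankel determinant divided by [4 beta^2 / 9] has eleven monomials, and the
   termwise triangle inequality already gives the bound 1: the resulting polynomial inequality in
   the moduli is checked in Bernstein form.
   Equality holds for [f = z (1 - z^3)^(- 2 beta / 3)], where [omega] is [z^2]. *)

(** * The polynomial inequality in the moduli *)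

(** The polynomials to which this is applied are only cubic in [t]; they are written in degree 6
    because their Bernstein coefficients of degree 3 are not all nonnegative. *)
Lemma bernstein6_nonneg (t b0 b1 b2 b3 b4 b5 b6 : R) :
  0 <= t <= 1 -> 0 <= b0 -> 0 <= b1 -> 0 <= b2 -> 0 <= b3 -> 0 <= b4 -> 0 <= b5 -> 0 <= b6 ->
  0 <= b0 * (1 - t) ^ 6 + 6 * b1 * (t * (1 - t) ^ 5) + 15 * b2 * (t ^ 2 * (1 - t) ^ 4)
       + 20 * b3 * (t ^ 3 * (1 - t) ^ 3) + 15 * b4 * (t ^ 4 * (1 - t) ^ 2)
       + 6 * b5 * (t ^ 5 * (1 - t)) + b6 * t ^ 6.
Proof.
  intros Ht ? ? ? ? ? ? ?.
  assert (Hp : forall n, 0 <= t ^ n) by (intro; apply pow_le; lra).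
  assert (Hq : forall n, 0 <= (1 - t) ^ n) by (intro; apply pow_le; lra).
  repeat apply Rplus_le_le_0_compat; repeat apply Rmult_le_pos; auto; lra.
Qed.

Ltac nonneg := first [lra | apply pow2_ge_0 | apply Rmult_le_pos; nonneg].

(* Proves quintic inequalities on [0, 1]; [m] should be close to the minimiser. *)
Ltac quintic_at x m :=
  assert (0 <= x * (x - m) ^ 2) by nonneg;
  assert (0 <= (1 - x) * (x - m) ^ 2) by nonneg;
  assert (0 <= x * x * (x - m) ^ 2) by nonneg;
  assert (0 <= x * (1 - x) * (x - m) ^ 2) by nonneg;
  assert (0 <= x * x * x * (x - m) ^ 2) by nonneg;
  assert (0 <= x * (1 - x)) by nonneg;
  assert (0 <= x * x * (1 - x)) by nonneg;
  assert (0 <= x * x * x * (1 - x)) by nonneg;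
  nra.

Ltac quintic x := first [solve [quintic_at x (2 / 3)] | quintic_at x (3 / 4)].

(* Upper bounds for [3/4 c^3 + c x (5/4 + c^2) + (1 - c^2) c x^2 / 4] with [t = c^2]:
   [c] and [c x] are replaced by the weighted AM-GM bounds
   [c <= 10/11 c^2 + 11/40] and [c x <= 5/8 c^2 + 2/5 x^2]. *)
Definition cross_bound (t x : R) : R :=
  3 / 4 * (t * (10 / 11 * t + 11 / 40))
  + (5 / 8 * t + 2 / 5 * x ^ 2) * (5 / 4 + t)
  + 1 / 4 * (1 - t) * x * (5 / 8 * t + 2 / 5 * x ^ 2).

(** Majorises the terms free of [e1] and [e2] in the factor of [u] in [hankel3_schur], with
    [t = |b0|^2], [x = |e0|] and each coefficient that depends on [beta] replaced by a uniform
    bound. *)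
Definition first_parameter_bound (t x : R) : R :=
  3 / 8 * t ^ 2 * x + t * x ^ 2 * (11 / 8 - 5 / 8 * t) + 9 / 16 * x ^ 3 * (1 + t)
  + (1 - t) * t * x ^ 4 / 8.

(* [h0], ..., [h6] are the degree 6 Bernstein coefficients in [t] of the difference of the two sides. *)
Lemma edge_bound_zero (t x : R) :
  0 <= t <= 1 -> 0 <= x <= 1 ->
  t ^ 3 / 40 + (1 - t) * (9 / 8 * (t + (1 - t) * x) * (1 - x ^ 2)
    + cross_bound t x * (1 - x ^ 2) + first_parameter_bound t x) <= 1.
Proof.
  intros Ht Hx.
  assert (h0 : 0 <= 1 - 9/8 * x - 1/2 * x ^ 2 + 37/80 * x ^ 3 + 1/2 * x ^ 4 + 1/10 * x ^ 5)
    by quintic x.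
  assert (h1 : 0 <= 311/480 - 149/192 * x - 173/480 * x ^ 2 + 47/320 * x ^ 3 + 37/80 * x ^ 4 + 1/15 * x ^ 5)
    by quintic x.
  assert (h2 : 0 <= 769/2200 - 81/160 * x - 63/550 * x ^ 2 - 67/800 * x ^ 3 + 83/200 * x ^ 4 + 1/25 * x ^ 5)
    by quintic x.
  assert (h3 : 0 <= 1487/8800 - 39/128 * x + 1241/8800 * x ^ 2 - 709/3200 * x ^ 3 + 281/800 * x ^ 4 + 1/50 * x ^ 5)
    by quintic x.
  assert (h4 : 0 <= 281/1650 - 77/480 * x + 511/1650 * x ^ 2 - 207/800 * x ^ 3 + 53/200 * x ^ 4 + 1/150 * x ^ 5)
    by quintic x.
  assert (h5 : 0 <= 147/352 - 1/16 * x + 519/1760 * x ^ 2 - 3/16 * x ^ 3 + 3/20 * x ^ 4)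
    by quintic x.
  assert (h6 : 0 <= 39/40)
    by quintic x.
  pose proof (bernstein6_nonneg t _ _ _ _ _ _ _ Ht h0 h1 h2 h3 h4 h5 h6) as H.
  apply Rminus_le; apply Ropp_le_cancel; rewrite Ropp_0.
  eapply Rle_trans; [exact H |].
  apply Req_le; unfold cross_bound, first_parameter_bound; field.
Qed.

(** The edge [y1 = 1 - x^2], where Carlson's bound leaves [y2 <= x (1 - x^2)]; [edge_bound_zero] is
    the edge [y1 = 0], with the cross term kept at its maximum. Equality holds at [t = x = 0], the
    extremal configuration, so [h0] vanishes at [x = 0]. *)
Lemma edge_bound_one (t x : R) :
  0 <= t <= 1 -> 0 <= x <= 1 ->
  t ^ 3 / 40 + (1 - t) * ((1 - t) * (1 - x ^ 2) ^ 2 + 9 / 8 * (t + (1 - t) * x) * (1 - x ^ 2) * x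
    + cross_bound t x * (1 - x ^ 2) + first_parameter_bound t x) <= 1.
Proof.
  intros Ht Hx.
  assert (h0 : 0 <= 3/8 * x ^ 2 - 53/80 * x ^ 3 + 5/8 * x ^ 4 + 1/10 * x ^ 5)
    by quintic x.
  assert (h1 : 0 <= 27/160 - 41/192 * x + 17/480 * x ^ 2 - 133/320 * x ^ 3 + 131/240 * x ^ 4 + 1/15 * x ^ 5)
    by quintic x.
  assert (h2 : 0 <= 549/2200 - 57/160 * x - 71/1100 * x ^ 2 - 187/800 * x ^ 3 + 93/200 * x ^ 4 + 1/25 * x ^ 5)
    by quintic x.
  assert (h3 : 0 <= 2697/8800 - 267/640 * x - 189/8800 * x ^ 2 - 349/3200 * x ^ 3 + 301/800 * x ^ 4 + 1/50 * x ^ 5)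
    by quintic x.
  assert (h4 : 0 <= 111/275 - 37/96 * x + 449/6600 * x ^ 2 - 27/800 * x ^ 3 + 41/150 * x ^ 4 + 1/150 * x ^ 5)
    by quintic x.
  assert (h5 : 0 <= 213/352 - 1/4 * x + 189/1760 * x ^ 2 + 3/20 * x ^ 4)
    by quintic x.
  assert (h6 : 0 <= 39/40)
    by quintic x.
  pose proof (bernstein6_nonneg t _ _ _ _ _ _ _ Ht h0 h1 h2 h3 h4 h5 h6) as H.
  apply Rminus_le; apply Ropp_le_cancel; rewrite Ropp_0.
  eapply Rle_trans; [exact H |].
  apply Req_le; unfold cross_bound, first_parameter_bound; field.
Qed.

(** Put [y1 = y (1 - x^2)]. With [y2] at its largest value and the cross term bounded by its value
    at [y = 1], the left side is affine in [y^2], so the edges [y = 0] and [y = 1] decide. *)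
Lemma modulus_bound (c x y1 y2 : R) :
  0 <= c <= 1 -> 0 <= x <= 1 -> 0 <= y1 -> y1 <= 1 - x ^ 2 -> 0 <= y2 ->
  (1 + x) * y2 <= (1 + x) * (1 - x ^ 2) - y1 ^ 2 ->
  (c ^ 2) ^ 3 / 40 + (1 - c ^ 2) * (9 / 8 * (c ^ 2 + (1 - c ^ 2) * x) * y2 + (1 - c ^ 2) * y1 ^ 2
    + (3 / 4 * c ^ 3 + c * x * (5 / 4 + c ^ 2) + 1 / 4 * (1 - c ^ 2) * c * x ^ 2) * y1
    + first_parameter_bound (c ^ 2) x) <= 1.
Proof.
  intros Hc Hx Hy1 Hy1' Hy2 Hy2'.
  assert (Ht : 0 <= c ^ 2 <= 1) by nra.
  pose proof (edge_bound_zero _ _ Ht Hx) as E0.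
  pose proof (edge_bound_one _ _ Ht Hx) as E1.
  assert (HL : 3 / 4 * c ^ 3 + c * x * (5 / 4 + c ^ 2) + 1 / 4 * (1 - c ^ 2) * c * x ^ 2
               <= cross_bound (c ^ 2) x).
  { unfold cross_bound.
    assert (A1 : c <= 10 / 11 * c ^ 2 + 11 / 40) by (pose proof (pow2_ge_0 (c - 11 / 20)); lra).
    assert (A2 : c * x <= 5 / 8 * c ^ 2 + 2 / 5 * x ^ 2)
      by (pose proof (pow2_ge_0 (c - 4 / 5 * x)); lra).
    assert (B1 := Rmult_le_compat_l _ _ _ (proj1 Ht) A1).
    assert (B2 := Rmult_le_compat_r (5 / 4 + c ^ 2) _ _ ltac:(lra) A2).
    assert (B3 := Rmult_le_compat_l (1 / 4 * (1 - c ^ 2) * x) _ _ ltac:(nonneg) A2).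
    lra. }
  assert (HL0 : 0 <= cross_bound (c ^ 2) x).
  { assert (0 <= x ^ 2) by nra. unfold cross_bound; repeat apply Rplus_le_le_0_compat; nonneg. }
  set (L := 3 / 4 * c ^ 3 + _ + _) in *.
  set (M := cross_bound (c ^ 2) x) in *.
  set (r := first_parameter_bound (c ^ 2) x) in *.
  set (t := c ^ 2) in *.
  assert (HLy : L * y1 <= M * (1 - x ^ 2)).
  { apply Rle_trans with (M * y1); [apply Rmult_le_compat_r; lra | apply Rmult_le_compat_l; lra]. }
  (* [y1 = y (1 - x^2)]; the remaining quadratic part is affine in [y^2] *)
  assert (exists y, 0 <= y <= 1 /\ y1 = y * (1 - x ^ 2)) as [y [Hy ->]].
  { destruct (Req_dec (1 - x ^ 2) 0) as [E | E].
    - exists 0; split; [lra | lra].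
    - exists (y1 / (1 - x ^ 2)); split; [| now field].
      assert (0 < 1 - x ^ 2) by lra.
      split; [apply Rle_div_r; lra | apply Rle_div_l; lra]. }
  assert (Hy2b : y2 <= (1 - x ^ 2) * (1 - (1 - x) * y ^ 2)).
  { apply Rmult_le_reg_l with (1 + x); [lra |].
    eapply Rle_trans; [exact Hy2' |]. apply Req_le; ring. }
  assert (HK : 0 <= 9 / 8 * (t + (1 - t) * x)) by nra.
  assert (Hs : 0 <= y ^ 2 <= 1) by nra.
  assert (HKy := Rmult_le_compat_l _ _ _ HK Hy2b).
  (* Convex combination of [E0] and [E1] with weights [1 - y^2] and [y^2]. *)
  apply Rle_trans with ((1 - y ^ 2) * 1 + y ^ 2 * 1); [| lra].
  eapply Rle_trans;
    [| apply Rplus_le_compat;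
       [apply Rmult_le_compat_l; [lra | exact E0] | apply Rmult_le_compat_l; [lra | exact E1]]].
  assert (Hu : 0 <= 1 - t) by lra.
  assert (H := Rmult_le_compat_l _ _ _ Hu (Rplus_le_compat _ _ _ _ HKy HLy)).
  lra.
Qed.

(** * Contractive Toeplitz matrices and Schur parameters *)

(** Multiplication by [b0 + b1 X] modulo [X^2], a lower triangular Toeplitz matrix, has operator
    norm at most 1; the next two definitions work modulo [X^3] and [X^4]. *)
Definition contraction2 (b0 b1 : C) : Prop :=
  forall w0 w1 : C,
  Cmod (b0 * w0) ^ 2 + Cmod (b1 * w0 + b0 * w1) ^ 2 <= Cmod w0 ^ 2 + Cmod w1 ^ 2.

Definition contraction3 (b0 b1 b2 : C) : Prop :=
  forall w0 w1 w2 : C,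
  Cmod (b0 * w0) ^ 2 + Cmod (b1 * w0 + b0 * w1) ^ 2
    + Cmod (b2 * w0 + b1 * w1 + b0 * w2) ^ 2
  <= Cmod w0 ^ 2 + Cmod w1 ^ 2 + Cmod w2 ^ 2.

Definition contraction4 (b0 b1 b2 b3 : C) : Prop :=
  forall w0 w1 w2 w3 : C,
  Cmod (b0 * w0) ^ 2 + Cmod (b1 * w0 + b0 * w1) ^ 2
    + Cmod (b2 * w0 + b1 * w1 + b0 * w2) ^ 2
    + Cmod (b3 * w0 + b2 * w1 + b1 * w2 + b0 * w3) ^ 2
  <= Cmod w0 ^ 2 + Cmod w1 ^ 2 + Cmod w2 ^ 2 + Cmod w3 ^ 2.

(* The Möbius transform [(v - c w) / (w - conj c v)] preserves contractivity. *)
Lemma Cmod_defect (c w d : C) :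
  Cmod (w + Cconj c * d) ^ 2 - Cmod (c * w + d) ^ 2
  = (1 - Cmod c ^ 2) * (Cmod w ^ 2 - Cmod d ^ 2).
Proof.
  rewrite !Cmod2_alt; destruct c, w, d; simpl; ring.
Qed.

Lemma RtoC_defect (c : C) : RtoC (1 - Cmod c ^ 2) = (1 - c * Cconj c)%C.
Proof. rewrite RtoC_minus, Cmod2_conj; reflexivity. Qed.

Lemma Cmod_sqr_eq_0 (z : C) : Cmod z ^ 2 <= 0 -> z = 0.
Proof.
  intro H; apply Cmod_eq_0; pose proof (Cmod_ge_0 z); nra.
Qed.

Lemma Cmod_div_R_sqr (z : C) (r : R) : 0 < r -> Cmod (z / r) ^ 2 = Cmod z ^ 2 / r ^ 2.
Proof.
  intro Hr. rewrite Cmod_div, Cmod_R, Rabs_pos_eq by (try (intro E; apply RtoC_inj in E); lra).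
  field; lra.
Qed.

(** One step of the Schur algorithm. With [c = b0] and [E = e0 + e1 X + e2 X^2], the formulas expand
    [B = (c + X E) / (1 + conj c X E)] modulo [X^4]; the defect identity then turns contractivity of
    [B] into contractivity of [E]. *)
Lemma schur_step4 (b0 b1 b2 b3 : C) :
  contraction4 b0 b1 b2 b3 ->
  Cmod b0 <= 1 /\
  exists e0 e1 e2 : C, contraction3 e0 e1 e2 /\
    let u := (1 - b0 * Cconj b0)%C in
    b1 = (u * e0)%C /\ b2 = (u * (e1 - Cconj b0 * e0 ^ 2))%C /\
    b3 = (u * (e2 - 2 * Cconj b0 * e0 * e1 + Cconj b0 ^ 2 * e0 ^ 3))%C.
Proof.
  intro H.
  (* The first basis vector bounds the norm of the first column by 1. *)
  pose proof (H 1 0 0 0)%C as H1.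
  ring_simplify (b0 * 1)%C (b1 * 1 + b0 * 0)%C (b2 * 1 + b1 * 0 + b0 * 0)%C
    (b3 * 1 + b2 * 0 + b1 * 0 + b0 * 0)%C in H1.
  rewrite Cmod_1, Cmod_0 in H1.
  pose proof (Cmod_ge_0 b0).
  pose proof (pow2_ge_0 (Cmod b1)). pose proof (pow2_ge_0 (Cmod b2)). pose proof (pow2_ge_0 (Cmod b3)).
  assert (Hc : Cmod b0 <= 1) by nra.
  split; [exact Hc |].
  destruct (Rle_lt_or_eq_dec _ _ Hc) as [Hlt | Heq].
  (* If [|b0| = 1], the first column leaves no room for [b1], [b2], [b3], so zero parameters
     serve. *)
  2:{ rewrite Heq in H1.
    exists 0%C, 0%C, 0%C; split.
    - intros w0 w1 w2.
      rewrite !Cmult_0_l, !Cplus_0_l, Cmod_0.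
      pose proof (pow2_ge_0 (Cmod w0)). pose proof (pow2_ge_0 (Cmod w1)).
      pose proof (pow2_ge_0 (Cmod w2)). lra.
    - rewrite (Cmod_sqr_eq_0 b1), (Cmod_sqr_eq_0 b2), (Cmod_sqr_eq_0 b3) by lra.
      simpl; repeat split; ring. }
  assert (Hu : 0 < 1 - Cmod b0 ^ 2) by nra.
  set (c' := Cconj b0).
  set (u := (1 - b0 * c')%C).
  assert (Eu : u = RtoC (1 - Cmod b0 ^ 2)) by (symmetry; apply RtoC_defect).
  assert (Hu0 : (1 - b0 * c')%C <> 0). { fold u. rewrite Eu. intro E; apply RtoC_inj in E; lra. }
  set (e0 := (b1 / u)%C). set (e1 := (b2 / u + c' * e0 ^ 2)%C).
  set (e2 := (b3 / u + 2 * c' * e0 * e1 - c' ^ 2 * e0 ^ 3)%C).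
  exists e0, e1, e2. split.
  2:{ simpl. unfold e2, e1, e0, u. repeat split; field; auto. }
  intros w0 w1 w2.
  set (d1 := (e0 * w0)%C). set (d2 := (e1 * w0 + e0 * w1)%C).
  set (d3 := (e2 * w0 + e1 * w1 + e0 * w2)%C).
  (* The test vector is [(1 + conj c X E) w / u], which [B] maps to [(c + X E) w / u]. The fourth
     coordinate of [w] is 0, and the common factor [1 / u] cancels at the end. *)
  pose proof (H (w0 / u) ((w1 + c' * d1) / u) ((w2 + c' * d2) / u) ((0 + c' * d3) / u))%C as Hw.
  replace (b0 * (w0 / u))%C with ((b0 * w0 + 0) / u)%C in Hw
   by (unfold u; field; auto).
  replace (b1 * (w0 / u) + b0 * ((w1 + c' * d1) / u))%C with ((b0 * w1 + d1) / u)%C in Hw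
   by (unfold d1, e0, u; field; auto).
  replace (b2 * (w0 / u) + b1 * ((w1 + c' * d1) / u) + b0 * ((w2 + c' * d2) / u))%C
    with ((b0 * w2 + d2) / u)%C in Hw by (unfold d2, d1, e1, e0, u; field; auto).
  replace (b3 * (w0 / u) + b2 * ((w1 + c' * d1) / u) + b1 * ((w2 + c' * d2) / u)
     + b0 * ((0 + c' * d3) / u))%C
    with ((b0 * 0 + d3) / u)%C in Hw by (unfold d3, d2, d1, e2, e1, e0, u; field; auto).
  replace (w0 / u)%C with ((w0 + c' * 0) / u)%C in Hw by (f_equal; ring).
  rewrite Eu, !Cmod_div_R_sqr in Hw by exact Hu.
  pose proof (Cmod_defect b0 w0 0) as K0. pose proof (Cmod_defect b0 w1 d1) as K1.
  pose proof (Cmod_defect b0 w2 d2) as K2. pose proof (Cmod_defect b0 0 d3) as K3.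
  fold c' in K0, K1, K2, K3. rewrite Cmod_0 in K0, K3.
  unfold Rdiv in Hw. rewrite <- !Rmult_plus_distr_r in Hw.
  apply Rmult_le_reg_r in Hw; [| apply Rinv_0_lt_compat, pow_lt, Hu].
  apply Rmult_le_reg_l with (1 - Cmod b0 ^ 2); [exact Hu |].
  rewrite !Rmult_plus_distr_l. lra.
Qed.

(** The same Schur step modulo [X^3]. *)
Lemma schur_step3 (b0 b1 b2 : C) :
  contraction3 b0 b1 b2 ->
  Cmod b0 <= 1 /\
  exists e0 e1 : C, contraction2 e0 e1 /\
    let u := (1 - b0 * Cconj b0)%C in
    b1 = (u * e0)%C /\ b2 = (u * (e1 - Cconj b0 * e0 ^ 2))%C.
Proof.
  intro H.
  pose proof (H 1 0 0)%C as H1.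
  ring_simplify (b0 * 1)%C (b1 * 1 + b0 * 0)%C (b2 * 1 + b1 * 0 + b0 * 0)%C in H1.
  rewrite Cmod_1, Cmod_0 in H1.
  pose proof (Cmod_ge_0 b0).
  pose proof (pow2_ge_0 (Cmod b1)). pose proof (pow2_ge_0 (Cmod b2)).
  assert (Hc : Cmod b0 <= 1) by nra.
  split; [exact Hc |].
  destruct (Rle_lt_or_eq_dec _ _ Hc) as [Hlt | Heq].
  2:{ rewrite Heq in H1.
    exists 0%C, 0%C; split.
    - intros w0 w1. rewrite !Cmult_0_l, !Cplus_0_l, Cmod_0.
      pose proof (pow2_ge_0 (Cmod w0)). pose proof (pow2_ge_0 (Cmod w1)). lra.
    - rewrite (Cmod_sqr_eq_0 b1), (Cmod_sqr_eq_0 b2) by lra.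
      simpl; split; ring. }
  assert (Hu : 0 < 1 - Cmod b0 ^ 2) by nra.
  set (c' := Cconj b0).
  set (u := (1 - b0 * c')%C).
  assert (Eu : u = RtoC (1 - Cmod b0 ^ 2)) by (symmetry; apply RtoC_defect).
  assert (Hu0 : (1 - b0 * c')%C <> 0) by (fold u; rewrite Eu; intro E; apply RtoC_inj in E; lra).
  set (e0 := (b1 / u)%C). set (e1 := (b2 / u + c' * e0 ^ 2)%C).
  exists e0, e1. split.
  2:{ simpl. unfold e1, e0, u. repeat split; field; auto. }
  intros w0 w1.
  set (d1 := (e0 * w0)%C). set (d2 := (e1 * w0 + e0 * w1)%C).
  pose proof (H (w0 / u) ((w1 + c' * d1) / u) ((0 + c' * d2) / u))%C as Hw.
  replace (b0 * (w0 / u))%C with ((b0 * w0 + 0) / u)%C in Hw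
    by (unfold u; field; auto).
  replace (b1 * (w0 / u) + b0 * ((w1 + c' * d1) / u))%C with ((b0 * w1 + d1) / u)%C in Hw
    by (unfold d1, e0, u; field; auto).
  replace (b2 * (w0 / u) + b1 * ((w1 + c' * d1) / u) + b0 * ((0 + c' * d2) / u))%C
    with ((b0 * 0 + d2) / u)%C in Hw by (unfold d2, d1, e1, e0, u; field; auto).
  replace (w0 / u)%C with ((w0 + c' * 0) / u)%C in Hw by (f_equal; ring).
  rewrite Eu, !Cmod_div_R_sqr in Hw by exact Hu.
  pose proof (Cmod_defect b0 w0 0) as K0. pose proof (Cmod_defect b0 w1 d1) as K1.
  pose proof (Cmod_defect b0 0 d2) as K2.
  fold c' in K0, K1, K2. rewrite Cmod_0 in K0, K2.
  unfold Rdiv in Hw. rewrite <- !Rmult_plus_distr_r in Hw.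
  apply Rmult_le_reg_r in Hw; [| apply Rinv_0_lt_compat, pow_lt, Hu].
  apply Rmult_le_reg_l with (1 - Cmod b0 ^ 2); [exact Hu |].
  rewrite !Rmult_plus_distr_l. lra.
Qed.

Lemma contraction2_pick (b0 b1 : C) :
  contraction2 b0 b1 -> Cmod b0 <= 1 /\ Cmod b1 <= 1 - Cmod b0 ^ 2.
Proof.
  intro H.
  pose proof (H 1 0)%C as H1.
  ring_simplify (b0 * 1)%C (b1 * 1 + b0 * 0)%C in H1.
  rewrite Cmod_1, Cmod_0 in H1.
  pose proof (Cmod_ge_0 b0). pose proof (Cmod_ge_0 b1).
  assert (Hc : Cmod b0 <= 1) by nra.
  split; [exact Hc |].
  destruct (Rle_lt_or_eq_dec _ _ Hc) as [Hlt | Heq]; [| rewrite Heq in *; nra].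
  set (u := 1 - Cmod b0 ^ 2).
  assert (Hu : 0 < u) by (unfold u; nra).
  (* the test vector maximising the second coordinate *)
  pose proof (H u (Cconj b0 * b1))%C as Hw.
  replace (b1 * u + b0 * (Cconj b0 * b1))%C with b1 in Hw
    by (unfold u; rewrite RtoC_defect; ring).
  rewrite !Cmod_mult, Cmod_conj, Cmod_R, Rabs_pos_eq in Hw by lra.
  assert (Hs : u * Cmod b1 ^ 2 <= u * u ^ 2) by (unfold u in *; nra).
  apply Rmult_le_reg_l in Hs; [| exact Hu].
  nra.
Qed.

(** Carlson's inequality, multiplied by [1 + |b0|] to avoid a quotient. A Schur step followed by
    [contraction2_pick] gives [|b2| <= u (1 - (1 - |b0|) |e0|^2)], where [|b1| = u |e0|] and
    [u = (1 - |b0|) (1 + |b0|)]. *)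
Lemma contraction3_carlson (b0 b1 b2 : C) :
  contraction3 b0 b1 b2 ->
  Cmod b0 <= 1 /\ Cmod b1 <= 1 - Cmod b0 ^ 2 /\
  (1 + Cmod b0) * Cmod b2 <= (1 + Cmod b0) * (1 - Cmod b0 ^ 2) - Cmod b1 ^ 2.
Proof.
  intro H.
  destruct (schur_step3 _ _ _ H) as [Hc [e0 [e1 [He E]]]].
  cbv zeta in E; rewrite <- RtoC_defect in E; destruct E as [E1 E2].
  destruct (contraction2_pick _ _ He) as [H0 H1].
  pose proof (Cmod_ge_0 b0). pose proof (Cmod_ge_0 e0).
  set (u := 1 - Cmod b0 ^ 2) in *.
  assert (Hu : 0 <= u) by (unfold u; nra).
  assert (M1 : Cmod b1 = u * Cmod e0) by (rewrite E1, Cmod_mult, Cmod_R, Rabs_pos_eq; lra).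
  assert (M2 : Cmod b2 <= u * (1 - Cmod e0 ^ 2 + Cmod b0 * Cmod e0 ^ 2)).
  { rewrite E2, Cmod_mult, Cmod_R, Rabs_pos_eq by lra.
    apply Rmult_le_compat_l; [lra |].
    eapply Rle_trans; [apply Cmod_triangle |].
    rewrite Cmod_opp, Cmod_mult, Cmod_conj, Cmod_pow. lra. }
  split; [exact Hc | split; [rewrite M1; nra |]].
  apply Rle_trans with ((1 + Cmod b0) * (u * (1 - Cmod e0 ^ 2 + Cmod b0 * Cmod e0 ^ 2))).
  - apply Rmult_le_compat_l; lra.
  - rewrite M1; apply Req_le; unfold u; ring.
Qed.

(** * The Hankel determinant in Schur parameters *)

(** The four relations for [a] compare coefficients in [g' = omega (2 beta g + z g')]. The result is
    grouped by monomials in [b0], [C0], [e0], [e1], [e2], ready for a termwise estimate. *)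
Lemma hankel3_schur (beta : R) (a : nat -> C) (b0 b1 b2 b3 e0 e1 e2 : C) :
  let b := RtoC beta in let C0 := Cconj b0 in
  let t := (b0 * C0)%C in let u := (1 - t)%C in
  (a 2%nat = 2 * b * b0)%C ->
  (2 * a 3%nat = 2 * b * b1 + (2 * b + 1) * a 2%nat * b0)%C ->
  (3 * a 4%nat = 2 * b * b2 + (2 * b + 1) * a 2%nat * b1 + (2 * b + 2) * a 3%nat * b0)%C ->
  (4 * a 5%nat = 2 * b * b3 + (2 * b + 1) * a 2%nat * b2 + (2 * b + 2) * a 3%nat * b1
                 + (2 * b + 3) * a 4%nat * b0)%C ->
  b1 = (u * e0)%C -> b2 = (u * (e1 - C0 * e0 ^ 2))%C ->
  b3 = (u * (e2 - 2 * C0 * e0 * e1 + C0 ^ 2 * e0 ^ 3))%C ->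
  hankel3 a = (4 * b ^ 2 / 9 *
    ((1 - b) * (b - 1 / 2) ^ 2 * (b + 1 / 2) * b0 ^ 6
     + u * (9 / 8 * (u * e0 - (2 * b - 1) * b0 ^ 2) * e2
            - u * e1 ^ 2
            + (2 * b ^ 2 - 3 / 2 * b + 1 / 4) * b0 ^ 3 * e1
            + (3 * b - 7 / 4 + (3 / 2 * b - 1 / 2) * t) * b0 * e0 * e1
            - 1 / 4 * u * C0 * e0 ^ 2 * e1
            + (3 / 2 * b ^ 3 - 1 / 2 * b ^ 2 - 9 / 8 * b + 1 / 2) * b0 ^ 4 * e0
            + (- (9 / 4) * b ^ 2 + 3 / 8 * b + 1 / 2
               + (1 / 4 * b ^ 2 + 9 / 8 * b - 3 / 4) * t) * b0 ^ 2 * e0 ^ 2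
            + (9 / 8 * (1 - b) - (1 / 2 + 3 / 4 * b) * t + (1 / 2 - 3 / 8 * b) * t ^ 2) * e0 ^ 3
            + 1 / 8 * u * C0 ^ 2 * e0 ^ 4)))%C.
Proof.
  intros b C0 t u E2 E3 E4 E5 F1 F2 F3.
  (* Writing [a 3] as [(2 * a 3) / 2] makes the left side of [E3] appear, so that the relations can
     be solved by rewriting; [G4] and [G5] do the same. *)
  assert (G3 : a 3%nat = ((2 * a 3%nat) / 2)%C) by (field). rewrite E3, E2 in G3.
  assert (G4 : a 4%nat = ((3 * a 4%nat) / 3)%C) by (field). rewrite E4, G3, E2 in G4.
  assert (G5 : a 5%nat = ((4 * a 5%nat) / 4)%C) by (field). rewrite E5, G4, G3, E2 in G5.
  rewrite hankel3E, G5, G4, G3, E2, F3, F2, F1. unfold u, t.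
  field.
Qed.

Lemma Cmod_plus_le (x y : C) (X Y : R) : Cmod x <= X -> Cmod y <= Y -> Cmod (x + y) <= X + Y.
Proof. intros; pose proof (Cmod_triangle x y); lra. Qed.

Lemma Cmod_minus_le (x y : C) (X Y : R) : Cmod x <= X -> Cmod y <= Y -> Cmod (x - y) <= X + Y.
Proof. intros; apply Cmod_plus_le; rewrite ?Cmod_opp; assumption. Qed.

Lemma Cmod_mult_le (x y : C) (X Y : R) : Cmod x <= X -> Cmod y <= Y -> Cmod (x * y) <= X * Y.
Proof.
  intros; rewrite Cmod_mult; apply Rmult_le_compat; auto using Cmod_ge_0.
Qed.

Lemma Cmod_RtoC_le (r X : R) : - X <= r <= X -> Cmod r <= X.
Proof. intros; rewrite Cmod_R; apply Rabs_le; assumption. Qed.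

Lemma Cmod_conj_le (x : C) : Cmod (Cconj x) <= Cmod x.
Proof. rewrite Cmod_conj; apply Rle_refl. Qed.

(** Builds the upper bound as an existential variable while descending through the expression; a
    real coefficient [r] takes its bound [X] from a hypothesis [- X <= r <= X]. *)
Ltac Cmod_le :=
  first
  [ apply Cmod_RtoC_le; eassumption
  | apply Cmod_minus_le; [Cmod_le | Cmod_le]
  | apply Cmod_plus_le; [Cmod_le | Cmod_le]
  | apply Cmod_mult_le; [Cmod_le | Cmod_le]
  | apply Cmod_conj_le | apply Rle_refl ].

Lemma hankel3_bound (beta : R) (a : nat -> C) (b0 b1 b2 b3 : C) :
  beta = 1 / 2 \/ 5 / 6 <= beta <= 1 ->
  contraction4 b0 b1 b2 b3 ->
  let b := RtoC beta in
  (a 2%nat = 2 * b * b0)%C ->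
  (2 * a 3%nat = 2 * b * b1 + (2 * b + 1) * a 2%nat * b0)%C ->
  (3 * a 4%nat = 2 * b * b2 + (2 * b + 1) * a 2%nat * b1 + (2 * b + 2) * a 3%nat * b0)%C ->
  (4 * a 5%nat = 2 * b * b3 + (2 * b + 1) * a 2%nat * b2 + (2 * b + 2) * a 3%nat * b1
                 + (2 * b + 3) * a 4%nat * b0)%C ->
  Cmod (hankel3 a) <= 4 * beta ^ 2 / 9.
Proof.
  intros Hbeta H b E2 E3 E4 E5.
  destruct (schur_step4 _ _ _ _ H) as [Hc [e0 [e1 [e2 [He [F1 [F2 F3]]]]]]].
  destruct (contraction3_carlson _ _ _ He) as [Hx [Hy1 Hy2]].
  rewrite (hankel3_schur beta a b0 b1 b2 b3 e0 e1 e2 E2 E3 E4 E5 F1 F2 F3).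
  pose proof (Cmod_ge_0 b0). pose proof (Cmod_ge_0 e0).
  pose proof (Cmod_ge_0 e1). pose proof (Cmod_ge_0 e2).
  pose proof (modulus_bound (Cmod b0) (Cmod e0) (Cmod e1) (Cmod e2)
    ltac:(lra) ltac:(lra) ltac:(lra) Hy1 ltac:(lra) Hy2) as M.
  rewrite <- Cmod2_conj.
  set (t := Cmod b0 ^ 2) in *.
  assert (Ht : 0 <= t <= 1) by (unfold t; nra).
  replace (4 * beta ^ 2 / 9) with (4 * beta ^ 2 / 9 * 1) by ring.
  (* From here on, one hypothesis for each real coefficient of [hankel3_schur], in the form that
     [Cmod_le] looks up, with bounds matching [modulus_bound]. Those in [K3], [KP], [K1] and [Kq]
     are the absolute values at [beta = 1]. *)
  assert (K9 : - (9 / 8) <= 9 / 8 <= 9 / 8) by lra.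
  assert (K4 : - (1 / 4 * (1 - t)) <= 1 / 4 * (1 - t) <= 1 / 4 * (1 - t)) by lra.
  assert (K8 : - (1 / 8 * (1 - t)) <= 1 / 8 * (1 - t) <= 1 / 8 * (1 - t)) by lra.
  assert (Ku : - (1 - t) <= 1 - t <= 1 - t) by lra.
  assert (Kh : - (4 * beta ^ 2 / 9) <= 4 * beta ^ 2 / 9 <= 4 * beta ^ 2 / 9) by nra.
  assert (K6 : - (1 / 40) <= (1 - beta) * (beta - 1 / 2) ^ 2 * (beta + 1 / 2) <= 1 / 40).
  { destruct Hbeta as [-> | Hb]; [lra |].
    assert (0 <= (1 - beta) * (beta - 1 / 2) ^ 2 * (beta + 1 / 2))
      by (repeat apply Rmult_le_pos; lra).
    (* The maximiser of the quartic is near [17/20]. The gap to [1/40] is this product plus an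
       affine function of [beta] that is nonnegative for [beta >= 5/6]. *)
    assert (0 <= (beta - 17 / 20) ^ 2
                 * ((beta - 1 / 2) ^ 2 + 6 / 5 * (beta - 1 / 2) + 87 / 400))
      by (apply Rmult_le_pos; [apply pow2_ge_0 | nra]).
    lra. }
  assert (Kk : - (1) <= 2 * beta - 1 <= 1) by lra.
  assert (K3 : - (3 / 4) <= 2 * beta ^ 2 - 3 / 2 * beta + 1 / 4 <= 3 / 4).
  { destruct Hbeta as [-> | Hb]; [lra |]. split; [nra | nra]. }
  assert (KP : - (5 / 4 + t) <= 3 * beta - 7 / 4 + (3 / 2 * beta - 1 / 2) * t <= 5 / 4 + t).
  { destruct Hbeta as [-> | Hb]; [lra |]. split; [nra | nra]. }
  assert (K1 : - (3 / 8) <= 3 / 2 * beta ^ 3 - 1 / 2 * beta ^ 2 - 9 / 8 * beta + 1 / 2 <= 3 / 8).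
  { destruct Hbeta as [-> | Hb]; [lra |]. split; [nra | nra]. }
  assert (Kq : - (11 / 8 - 5 / 8 * t) <= - (9 / 4) * beta ^ 2 + 3 / 8 * beta + 1 / 2
               + (1 / 4 * beta ^ 2 + 9 / 8 * beta - 3 / 4) * t <= 11 / 8 - 5 / 8 * t).
  { destruct Hbeta as [-> | Hb]; [lra |].
    assert (0 <= (1 - beta) * (9 / 4 * (1 + beta) - 3 / 8 - (1 / 4 * (1 + beta) + 9 / 8) * t))
      by (apply Rmult_le_pos; nra).
    split; [lra | nra]. }
  (* The bound is reached at [t = 0] for [beta = 1/2] and, in absolute value, at [t = 1] for
     [beta = 1]. *)
  assert (Kr : - (9 / 16 * (1 + t)) <= 9 / 8 * (1 - beta) - (1 / 2 + 3 / 4 * beta) * t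
               + (1 / 2 - 3 / 8 * beta) * t ^ 2 <= 9 / 16 * (1 + t)).
  { destruct Hbeta as [-> | Hb]; [split; [nra | nra]|].
    assert (0 <= (1 - beta) * (9 / 8 + 3 / 4 * t + 3 / 8 * t ^ 2)) by (apply Rmult_le_pos; nra).
    assert (0 <= (1 - t) * (9 / 16 - t / 8)) by (apply Rmult_le_pos; lra).
    split; [lra | nra]. }
  eapply Rle_trans; [| apply Rmult_le_compat_l; [nra | exact M]].
  (* Each coefficient is collected into a single [RtoC] so that the hypotheses above match
     syntactically. *)
  unfold b; repeat (rewrite <- RtoC_opp || rewrite <- RtoC_plus || rewrite <- RtoC_minus
    || rewrite <- RtoC_mult || rewrite <- RtoC_pow || rewrite <- RtoC_div by lra).
  eapply Rle_trans; [Cmod_le |].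
  rewrite Cmod_1; apply Req_le; unfold first_parameter_bound, t; field.
Qed.

(** * Complex derivatives and power series *)

(** The codomain is [C] as a module over itself, where the product and chain rules apply directly;
    [is_derive_cderiv] passes to [C_NormedModule]. *)
Definition cderiv (f : C -> C) (z l : C) : Prop :=
  is_derive (K := C_AbsRing) (V := AbsRing_NormedModule C_AbsRing) f z l.

Definition cseries (a : nat -> C) (z l : C) : Prop :=
  is_pseries (K := C_AbsRing) (V := C_NormedModule) a z l.

Lemma cderiv_intro (f : C -> C) (z l : C) :
  (forall eps, 0 < eps -> exists delta, 0 < delta /\ forall w, Cmod (w - z) < delta ->
     Cmod (f w - f z - (w - z) * l) <= eps * Cmod (w - z)) ->
  cderiv f z l.
Proof.
  intro H; split; [apply is_linear_scal_l |].
  intros x Hx eps.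
  assert (E : z = x)
      by (apply (is_filter_lim_locally_unique (V := AbsRing_NormedModule C_AbsRing)); exact Hx).
  subst x.
  destruct (H eps (cond_pos eps)) as [d [Hd Hw]].
  exists (mkposreal d Hd); intros w Bw; exact (Hw w Bw).
Qed.

Lemma cderiv_elim (f : C -> C) (z l : C) (eps : R) :
  cderiv f z l -> 0 < eps ->
  exists delta, 0 < delta /\ forall w, Cmod (w - z) < delta ->
     Cmod (f w - f z - (w - z) * l) <= eps * Cmod (w - z).
Proof.
  intros [_ H] He.
  destruct (H z (fun P HP => HP) (mkposreal eps He)) as [d Hd].
  exists d; split; [apply cond_pos |]; intros w Bw; exact (Hd w Bw).
Qed.

Lemma is_derive_cderiv (f : C -> C) (z l : C) :
  is_derive (K := C_AbsRing) (V := C_NormedModule) f z l <-> cderiv f z l.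
Proof.
  split.
  - intros [_ H]; split; [apply is_linear_scal_l | exact H].
  - intros [_ H]; split; [apply is_linear_scal_l | exact H].
Qed.

Lemma cderiv_unique (f : C -> C) (z l : C) : cderiv f z l -> C_derive f z = l.
Proof. intro H; apply is_C_derive_unique, is_derive_cderiv, H. Qed.

Lemma cderiv_eq (f : C -> C) (z l l' : C) : cderiv f z l -> l = l' -> cderiv f z l'.
Proof. intros H <-; exact H. Qed.

Lemma cderiv_const (a z : C) : cderiv (fun _ => a) z 0.
Proof. exact (is_derive_const (K := C_AbsRing) (V := AbsRing_NormedModule C_AbsRing) a z). Qed.

Lemma cderiv_id (z : C) : cderiv (fun w => w) z 1.
Proof. exact (is_derive_id (K := C_AbsRing) z). Qed.

Lemma cderiv_plus (f g : C -> C) (z l m : C) :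
  cderiv f z l -> cderiv g z m -> cderiv (fun w => f w + g w)%C z (l + m)%C.
Proof. exact (is_derive_plus (K := C_AbsRing) (V := AbsRing_NormedModule C_AbsRing) f g z l m). Qed.

Lemma cderiv_mult (f g : C -> C) (z l m : C) :
  cderiv f z l -> cderiv g z m -> cderiv (fun w => f w * g w)%C z (l * g z + f z * m)%C.
Proof.
  intros Hf Hg; exact (is_derive_mult (K := C_AbsRing) f g z l m Hf Hg Cmult_comm).
Qed.

Lemma cderiv_scal (a : C) (f : C -> C) (z l : C) :
  cderiv f z l -> cderiv (fun w => a * f w)%C z (a * l)%C.
Proof.
  intro H; eapply cderiv_eq; [exact (cderiv_mult _ _ z _ _ (cderiv_const a z) H) | cbv beta; ring].
Qed.

Lemma Cmod_minus_sym (x y : C) : Cmod (x - y) = Cmod (y - x).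
Proof. rewrite <- Cmod_opp; f_equal; ring. Qed.

Lemma cderiv_Cinv (z : C) : z <> 0 -> cderiv Cinv z (- / (z * z))%C.
Proof.
  intros Hz; apply cderiv_intro; intros eps He.
  pose proof (proj1 (Cmod_gt_0 z) Hz) as Hm.
  set (m := Cmod z) in *.
  (* The error is [(w - z)^2 / (w z^2)]: the first bound keeps [|w| > m / 2], and the second then
     makes the error at most [eps |w - z|]. *)
  exists (Rmin (m / 2) (eps * m ^ 3 / 2)); split.
  { apply Rmin_pos; [lra |]. assert (0 < m ^ 3) by (apply pow_lt; lra). nra. }
  intros w Hw.
  assert (Hw1 : Cmod (w - z) < m / 2) by (eapply Rlt_le_trans; [exact Hw | apply Rmin_l]).
  assert (Hw2 : Cmod (w - z) < eps * m ^ 3 / 2)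
    by (eapply Rlt_le_trans; [exact Hw | apply Rmin_r]).
  assert (Hwm : m / 2 < Cmod w).
  { pose proof (Cmod_triangle w (z - w)) as T.
    replace (w + (z - w))%C with z in T by ring. rewrite (Cmod_minus_sym z w) in T.
    fold m in T; lra. }
  assert (Hw0 : w <> 0) by (apply Cmod_gt_0; lra).
  replace (/ w - / z - (w - z) * - / (z * z))%C with ((w - z) * (w - z) / (w * (z * z)))%C
    by (field; auto).
  rewrite Cmod_div by (repeat apply Cmult_neq_0; auto).
  rewrite !Cmod_mult; fold m.
  apply Rle_div_l; [apply Rmult_lt_0_compat; nra |].
  rewrite (Rmult_comm eps), Rmult_assoc; apply Rmult_le_compat_l; [apply Cmod_ge_0 |].
  apply Rle_trans with (eps * m ^ 3 / 2); [lra |].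
  replace (eps * m ^ 3 / 2) with (eps * (m / 2 * (m * m))) by field.
  apply Rmult_le_compat_l; [lra |]. apply Rmult_le_compat_r; nra.
Qed.

Lemma cderiv_inv (f : C -> C) (z l : C) :
  cderiv f z l -> f z <> 0 -> cderiv (fun w => / f w)%C z (- l * / f z * / f z)%C.
Proof.
  intros Hf H0.
  apply cderiv_eq with (l * - / (f z * f z))%C; [| field; exact H0].
  exact (is_derive_comp (K := C_AbsRing) (V := AbsRing_NormedModule C_AbsRing) Cinv f z _ _
           (cderiv_Cinv _ H0) Hf).
Qed.

Lemma cderiv_ext (f g : C -> C) (z l : C) :
  (forall w, f w = g w) -> cderiv f z l -> cderiv g z l.
Proof. exact (is_derive_ext (K := C_AbsRing) (V := AbsRing_NormedModule C_AbsRing) f g z l). Qed.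

Lemma cderiv_opp (f : C -> C) (z l : C) : cderiv f z l -> cderiv (fun w => - f w)%C z (- l)%C.
Proof.
  intro H; apply (cderiv_ext (fun w => - (1) * f w)%C); [intro; ring |].
  eapply cderiv_eq; [apply cderiv_scal, H | ring].
Qed.

Lemma cderiv_continuous (f : C -> C) (z l : C) (eps : R) :
  cderiv f z l -> 0 < eps ->
  exists delta, 0 < delta /\ forall w, Cmod (w - z) < delta -> Cmod (f w - f z) < eps.
Proof.
  intros H He.
  destruct (cderiv_elim f z l 1 H Rlt_0_1) as [d [Hd Hw]].
  pose proof (Cmod_ge_0 l).
  exists (Rmin d (eps / (2 + Cmod l))); split.
  { apply Rmin_pos; [exact Hd | apply Rdiv_lt_0_compat; lra]. }
  intros w Bw.
  assert (B1 : Cmod (w - z) < d) by (eapply Rlt_le_trans; [exact Bw | apply Rmin_l]).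
  assert (B2 : Cmod (w - z) < eps / (2 + Cmod l))
    by (eapply Rlt_le_trans; [exact Bw | apply Rmin_r]).
  apply Rlt_div_r in B2; [| lra].
  specialize (Hw w B1).
  replace (f w - f z)%C with ((f w - f z - (w - z) * l) + (w - z) * l)%C by ring.
  eapply Rle_lt_trans; [apply Cmod_triangle |].
  rewrite Cmod_mult. pose proof (Cmod_ge_0 (w - z)). nra.
Qed.

Lemma Cmod_le_abs (z : C) : Cmod z <= Rabs (Re z) + Rabs (Im z).
Proof.
  pose proof (Rabs_pos (Re z)); pose proof (Rabs_pos (Im z)).
  rewrite <- (sqrt_pow2 (Rabs (Re z) + Rabs (Im z))) by lra.
  apply sqrt_le_1_alt. fold (Re z) (Im z).
  rewrite <- (pow2_abs (Re z)), <- (pow2_abs (Im z)); nra.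
Qed.

Lemma prod_norm_Cmod (p : prod_NormedModule R_AbsRing R_NormedModule R_NormedModule) :
  norm p = Cmod p.
Proof.
  destruct p as [p1 p2].
  unfold norm; simpl; unfold prod_norm, Cmod; simpl; f_equal.
  unfold norm; simpl; unfold abs; simpl.
  rewrite !Rmult_1_r, <- !Rabs_mult, !Rabs_pos_eq by apply Rle_0_sqr; reflexivity.
Qed.

(* Real derivative of [Re f] along a curve [(x, y)]: the chain rule across the two scalar fields. *)
Lemma is_derive_Re_curve (f : C -> C) (x y : R -> R) (t x' y' : R) (l : C) :
  is_derive x t x' -> is_derive y t y' -> cderiv f (x t, y t) l ->
  is_derive (fun s => Re (f (x s, y s))) t (Re ((x', y') * l)%C).
Proof.
  intros Hx Hy Hf.
  assert (Hh : filterdiff (K := R_AbsRing) (V := R_NormedModule)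
     (fun p : prod_NormedModule R_AbsRing R_NormedModule R_NormedModule =>
        Re (f (fst p, snd p)))
     (locally (x t, y t))
     (fun p => Re ((fst p, snd p) * l)%C)).
  { split.
    - split.
      + intros [p1 p2] [q1 q2]; simpl. unfold plus; simpl. ring.
      + intros k [p1 p2]; simpl. unfold scal; simpl; unfold mult; simpl. ring.
      + exists (Cmod l + 1); split; [pose proof (Cmod_ge_0 l); lra |].
        intros p. eapply Rle_trans; [apply re_le_Cmod |].
        rewrite Cmod_mult, Rmult_comm.
        rewrite prod_norm_Cmod; destruct p as [p1 p2].
        apply Rmult_le_compat_r; [apply Cmod_ge_0 | lra].
    - intros p Hp eps.
      assert (E : (x t, y t) = p).
      { apply (is_filter_lim_locally_unique
          (V := prod_NormedModule R_AbsRing R_NormedModule R_NormedModule)); exact Hp. }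
      subst p.
      destruct (cderiv_elim f _ l eps Hf (cond_pos eps)) as [d [Hd Hw]].
      (* Balls in the product are squares; half the side is taken because [Cmod] is at most the sum
         of the two coordinate moduli. *)
      assert (Hd2 : 0 < d / 2) by lra.
      exists (mkposreal _ Hd2); intros [p1 p2] [B1 B2]; simpl in B1, B2.
      change (Rabs (p1 - x t) < d / 2) in B1; change (Rabs (p2 - y t) < d / 2) in B2.
      assert (Hp2 : Cmod ((p1, p2) - (x t, y t)) < d).
      { eapply Rle_lt_trans; [apply Cmod_le_abs |].
        change (Rabs (p1 - x t) + Rabs (p2 - y t) < d); lra. }
      specialize (Hw _ Hp2).
      eapply Rle_trans; [| eapply Rle_trans; [exact Hw |]].
      + eapply Rle_trans; [| apply re_le_Cmod]. apply Req_le.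
        unfold norm; simpl; unfold abs; simpl; f_equal.
      + rewrite <- prod_norm_Cmod. apply Rle_refl. }
  pose proof (filterdiff_comp'_2 (K := R_AbsRing) x y (fun u v => Re (f (u, v))) t _ _
     (fun u v => Re ((u, v) * l)%C) Hx Hy Hh) as K.
  eapply filterdiff_ext_lin; [exact K |].
  intros s; simpl. unfold scal; simpl; unfold mult; simpl. ring.
Qed.

(** * Complex power series and termwise differentiation *)

Lemma pow_n_Cpow (z : C) (n : nat) : pow_n (K := C_Ring) z n = (z ^ n)%C.
Proof. induction n as [| n IH]; [reflexivity |]. simpl; rewrite IH; reflexivity. Qed.

Notation Cis_series := (is_series (K := C_AbsRing) (V := C_NormedModule)).

Lemma Cis_series_ext (a b : nat -> C) (l : C) :
  (forall n, a n = b n) -> Cis_series a l -> Cis_series b l.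
Proof. exact (is_series_ext (V := C_NormedModule) a b l). Qed.

Lemma Cis_series_eq (a : nat -> C) (l m : C) : Cis_series a l -> l = m -> Cis_series a m.
Proof. intros H <-; exact H. Qed.

Lemma Cis_series_plus (a b : nat -> C) (l m : C) :
  Cis_series a l -> Cis_series b m -> Cis_series (fun n => a n + b n)%C (l + m)%C.
Proof. exact (is_series_plus (V := C_NormedModule) a b l m). Qed.

Lemma Cis_series_minus (a b : nat -> C) (l m : C) :
  Cis_series a l -> Cis_series b m -> Cis_series (fun n => a n - b n)%C (l - m)%C.
Proof. exact (is_series_minus (V := C_NormedModule) a b l m). Qed.

Lemma Cis_series_scal (c : C) (a : nat -> C) (l : C) :
  Cis_series a l -> Cis_series (fun n => c * a n)%C (c * l)%C.
Proof. exact (is_series_scal (V := C_NormedModule) c a l). Qed.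

Lemma Cis_series_tail (a : nat -> C) (l : C) :
  Cis_series (fun n => a (S n)) (l - a 0%nat)%C <-> Cis_series a l.
Proof.
  split; [exact (is_series_decr_1 (V := C_NormedModule) a l) |].
  intro H; apply (is_series_incr_1 (V := C_NormedModule) a).
  refine (Cis_series_eq _ _ _ H _).
  change (l = (l - a 0%nat + a 0%nat)%C); ring.
Qed.

Lemma cseries_Cpow (a : nat -> C) (z l : C) :
  cseries a z l <->
  Cis_series (fun n => z ^ n * a n)%C l.
Proof.
  unfold cseries, is_pseries; split; apply is_series_ext; intro n.
  - exact (f_equal (fun t => (t * a n)%C) (pow_n_Cpow z n)).
  - exact (f_equal (fun t => (t * a n)%C) (eq_sym (pow_n_Cpow z n))).
Qed.

Lemma cseries_unique (a : nat -> C) (z l m : C) : cseries a z l -> cseries a z m -> l = m.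
Proof. apply (filterlim_locally_unique (V := C_NormedModule)). Qed.

Lemma Cmod_series_le (a : nat -> C) (b : nat -> R) (l : C) (B : R) :
  Cis_series a l -> is_series b B ->
  (forall n, Cmod (a n) <= b n) -> Cmod l <= B.
Proof.
  intros Ha Hb H.
  assert (L : is_lim_seq (fun n => Cmod (sum_n (G := C_NormedModule) a n)) (Cmod l)).
  { apply (filterlim_comp _ _ _ _ (norm (V := C_NormedModule)) _ _ _ Ha).
    apply (filterlim_norm (V := C_NormedModule)). }
  refine (is_lim_seq_le _ _ (Cmod l) B _ L Hb).
  intro n. eapply Rle_trans; [apply (norm_sum_n_m (V := C_NormedModule)) |].
  apply sum_n_m_le; intro k; apply H.
Qed.

Definition cseries_on_disc (a : nat -> C) (f : C -> C) : Prop :=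
  forall z, in_disc z -> cseries a z (f z).

Lemma cseries_terms_bounded (a : nat -> C) (f : C -> C) (r : R) :
  cseries_on_disc a f -> 0 <= r < 1 ->
  exists M, forall n, Rabs (Cmod (a n) * r ^ n) <= M.
Proof.
  intros H Hr.
  assert (Hd : in_disc r) by (unfold in_disc; rewrite Cmod_R, Rabs_pos_eq; lra).
  pose proof (proj1 (cseries_Cpow _ _ _) (H r Hd)) as Hs.
  destruct (filterlim_bounded (V := C_NormedModule) _ (ex_intro _ _ Hs)) as [M HM].
  exists (M + M); intro n.
  assert (E : Cmod (a n) * r ^ n = Cmod (r ^ n * a n)%C).
  { rewrite Cmod_mult, Cmod_pow, Cmod_R, (Rabs_pos_eq r) by lra; ring. }
  rewrite E, Rabs_pos_eq by apply Cmod_ge_0.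
  assert (Hn : forall k, Cmod (sum_n (G := C_NormedModule) (fun n => r ^ n * a n)%C k) <= M)
    by (intro k; apply HM).
  destruct n as [| n].
  - pose proof (Hn 0%nat) as H0. rewrite sum_O in H0.
    pose proof (Cmod_ge_0 (r ^ 0 * a 0%nat)). lra.
  - pose proof (Hn n) as H1. pose proof (Hn (S n)) as H2. rewrite sum_Sn in H2.
    set (s := sum_n _ n) in *. set (t := (r ^ S n * a (S n))%C) in *.
    replace t with ((s + t) - s)%C by ring.
    eapply Rle_trans; [apply Cmod_triangle |]. rewrite Cmod_opp.
    apply Rplus_le_compat; assumption.
Qed.

(** The terms are bounded at the larger radius [(1 + r) / 2]. This makes real power series in the
    moduli [|a n|] available as majorants. *)
Lemma cseries_CV_radius (a : nat -> C) (f : C -> C) (r : R) :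
  cseries_on_disc a f -> 0 <= r < 1 ->
  Rbar_lt (Rabs r) (CV_radius (fun n => Cmod (a n))).
Proof.
  intros H Hr. rewrite Rabs_pos_eq by lra.
  apply Rbar_lt_le_trans with ((1 + r) / 2); [simpl; lra |].
  apply (proj1 (CV_radius_bounded _)).
  apply (cseries_terms_bounded a f); [exact H | lra].
Qed.

Definition coeffs_deriv (a : nat -> C) (n : nat) : C := (INR (S n) * a (S n))%C.

(** Induction through [R(n+1) = w R(n) + (n + 2) z^(n+1) (w - z)^2] for the remainder [R]. The
    constant is twice the optimal one, but it is the coefficient that appears in a second
    derivative. *)
Lemma Cpow_second_difference (w z : C) (rho : R) (n : nat) :
  Cmod w <= rho -> Cmod z <= rho ->
  Cmod (w ^ S (S n) - z ^ S (S n) - (w - z) * (INR (S (S n)) * z ^ S n))%C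
  <= INR (S n) * INR (S (S n)) * rho ^ n * Cmod (w - z) ^ 2.
Proof.
  intros Hw Hz.
  assert (Hr : 0 <= rho) by (pose proof (Cmod_ge_0 w); lra).
  pose proof (pow2_ge_0 (Cmod (w - z))) as Hh.
  induction n as [| n IH].
  - replace (w ^ 2 - z ^ 2 - (w - z) * (INR 2 * z ^ 1))%C with ((w - z) ^ 2)%C
      by (simpl INR; rewrite RtoC_plus; ring).
    rewrite Cmod_pow; simpl INR; simpl pow. nra.
  - replace (w ^ S (S (S n)) - z ^ S (S (S n)) - (w - z) * (INR (S (S (S n))) * z ^ S (S n)))%C
      with (w * (w ^ S (S n) - z ^ S (S n) - (w - z) * (INR (S (S n)) * z ^ S n))
            + INR (S (S n)) * z ^ S n * (w - z) ^ 2)%C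
      by (rewrite (S_INR (S (S n))), RtoC_plus, !Cpow_S; ring).
    eapply Rle_trans; [apply Cmod_triangle |].
    rewrite !Cmod_mult, !Cmod_pow, Cmod_R, (Rabs_pos_eq (INR _)) by apply pos_INR.
    pose proof (pos_INR (S n)) as Hn.
    assert (P : Cmod z ^ S n <= rho ^ S n) by (apply pow_incr; split; [apply Cmod_ge_0 | exact Hz]).
    apply Rle_trans with (rho * (INR (S n) * INR (S (S n)) * rho ^ n * Cmod (w - z) ^ 2)
      + INR (S (S n)) * rho ^ S n * Cmod (w - z) ^ 2).
    + apply Rplus_le_compat.
      * apply Rmult_le_compat; auto using Cmod_ge_0.
      * apply Rmult_le_compat_r; [exact Hh |]. apply Rmult_le_compat_l; [apply pos_INR | exact P].
    + rewrite (S_INR (S (S n))), (S_INR (S n)). simpl pow.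
      assert (0 <= rho * rho ^ n) by (apply Rmult_le_pos; [exact Hr | apply pow_le, Hr]).
      assert (0 <= rho * rho ^ n * Cmod (w - z) ^ 2) by (apply Rmult_le_pos; assumption).
      simpl pow in *. nra.
Qed.

(** Summing [Cpow_second_difference] over the series bounds the error of the linear approximation by
    [K |w - z|^2], where [K] is the second derivative series of the moduli at a radius [rho] between
    [|z|] and 1. *)
Lemma cseries_derivative_at (a : nat -> C) (f : C -> C) (z : C) :
  cseries_on_disc a f -> in_disc z ->
  exists d, cseries (coeffs_deriv a) z d /\ cderiv f z d.
Proof.
  intros H Hz. unfold in_disc in Hz.
  pose proof (Cmod_ge_0 z) as Hz0.
  set (rho := (1 + Cmod z) / 2).
  assert (Hrho : 0 <= rho < 1) by (unfold rho; lra).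
  assert (Hzr : Cmod z < rho) by (unfold rho; lra).
  pose proof (cseries_CV_radius a f rho H Hrho) as Hrad.
  assert (S1 := Hrad); rewrite <- CV_radius_derive in S1.
  assert (S2 := S1); rewrite <- CV_radius_derive in S2.
  apply CV_disk_inside in S1; apply CV_disk_inside in S2.
  destruct S2 as [K HK].
  assert (Xd : exists d : C, Cis_series (fun n => z ^ n * coeffs_deriv a n)%C d).
  { refine (ex_series_le (K := C_AbsRing) (V := C_CompleteNormedModule) _ _ _ S1).
    intro n. change (Cmod (z ^ n * coeffs_deriv a n)
       <= Rabs (PS_derive (fun n => Cmod (a n)) n * rho ^ n)).
    unfold coeffs_deriv, PS_derive.
    rewrite Rabs_mult, (Rabs_pos_eq (_ * _)), (Rabs_pos_eq (rho ^ n)), !Cmod_mult, Cmod_pow, Cmod_R,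
      (Rabs_pos_eq (INR _)), Rmult_comm
      by first [apply pos_INR |
        apply pow_le; lra | apply Rmult_le_pos; [apply pos_INR | apply Cmod_ge_0]].
    apply Rmult_le_compat_l; [apply Rmult_le_pos; [apply pos_INR | apply Cmod_ge_0] |].
    apply pow_incr; lra. }
  destruct Xd as [d Hd].
  exists d; split; [apply cseries_Cpow; exact Hd |].
  assert (Hq : forall w, Cmod (w - z) < rho - Cmod z ->
     Cmod (f w - f z - (w - z) * d) <= K * Cmod (w - z) ^ 2).
  { intros w Hw.
    assert (Hwr : Cmod w < rho).
    { pose proof (Cmod_triangle (w - z) z) as T. replace (w - z + z)%C with w in T by ring. lra. }
    assert (Hwd : in_disc w) by (unfold in_disc; lra).
    pose proof (proj1 (cseries_Cpow _ _ _) (H w Hwd)) as Sw.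
    pose proof (proj1 (cseries_Cpow _ _ _) (H z Hz)) as Sz.
    (* The derivative series is shifted by one, with a zero term in front, to align it with the
       series of [f]. *)
    assert (Sd : Cis_series
      (fun n => INR n * z ^ pred n * a n)%C d).
    { refine (proj1 (Cis_series_tail _ _) _).
      apply Cis_series_ext with (fun n => z ^ n * coeffs_deriv a n)%C.
      - intro n; unfold coeffs_deriv; simpl pred; ring.
      - replace (d - _)%C with d by (simpl INR; ring). exact Hd. }
    pose proof (Cis_series_minus _ _ _ _ (Cis_series_minus _ _ _ _ Sw Sz)
      (Cis_series_scal (w - z)%C _ _ Sd)) as St.
    (* The terms of index 0 and 1 of the combined series vanish and are dropped. *)
    apply Cis_series_tail, Cis_series_tail in St; cbv beta in St.
    apply (is_series_scal_r (Cmod (w - z) ^ 2)) in HK.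
    eapply Cmod_series_le.
    2: exact HK.
    - refine (Cis_series_eq _ _ _ St _).
      simpl INR; simpl pred; ring.
    - intro n; cbv beta.
      match goal with |- Cmod ?x <= _ => replace x
        with ((w ^ S (S n) - z ^ S (S n) - (w - z) * (INR (S (S n)) * z ^ S n)) * a (S (S n)))%C
          by (simpl pred; ring) end.
      rewrite Cmod_mult.
      pose proof (Cpow_second_difference w z rho n ltac:(lra) ltac:(lra)) as Q.
      pose proof (Cmod_ge_0 (a (S (S n)))) as Qa.
      apply Rmult_le_compat_r with (r := Cmod (a (S (S n)))) in Q; [| exact Qa].
      eapply Rle_trans; [exact Q |]. unfold PS_derive.
      rewrite Rabs_pos_eq.
      + apply Req_le; ring.
      + repeat apply Rmult_le_pos; auto using pos_INR. apply pow_le; lra. }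
  apply cderiv_intro; intros eps He.
  assert (HK0 : 0 <= K).
  { eapply Rle_trans; [apply Cmod_ge_0 |].
    apply (Cmod_series_le _ _ _ _ (Cis_series_minus _ _ _ _ Hd Hd) HK).
    intro n; unfold Cminus; rewrite Cplus_opp_r, Cmod_0; apply Rabs_pos. }
  exists (Rmin (rho - Cmod z) (eps / (K + 1))); split.
  { apply Rmin_pos; [lra | apply Rdiv_lt_0_compat; lra]. }
  intros w Hw.
  eapply Rle_trans; [apply Hq; eapply Rlt_le_trans; [exact Hw | apply Rmin_l] |].
  assert (B : Cmod (w - z) < eps / (K + 1)) by (eapply Rlt_le_trans; [exact Hw | apply Rmin_r]).
  apply Rlt_div_r in B; [| lra].
  pose proof (Cmod_ge_0 (w - z)). nra.
Qed.

Lemma cseries_deriv (a : nat -> C) (f : C -> C) :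
  cseries_on_disc a f ->
  cseries_on_disc (coeffs_deriv a) (C_derive f) /\
  forall z, in_disc z -> cderiv f z (C_derive f z).
Proof.
  intro H; split; intros z Hz; destruct (cseries_derivative_at a f z H Hz) as [d [Hs Hd]];
    rewrite (cderiv_unique f z d Hd); assumption.
Qed.

(** Division by [z] with the singularity filled by [a 1]; it yields [f / z] and, when iterated, the
    Taylor remainders. *)
Lemma cseries_tail (a : nat -> C) (f : C -> C) :
  cseries_on_disc a f ->
  exists g, cseries_on_disc (fun n => a (S n)) g /\
    forall z, in_disc z -> f z = (a 0%nat + z * g z)%C.
Proof.
  intro H.
  exists (fun z => if Ceq_dec z 0 then a 1%nat else ((f z - a 0%nat) / z)%C); split.
  - intros z Hz. apply cseries_Cpow.
    pose proof (proj1 (cseries_Cpow _ _ _) (H z Hz)) as Hs.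
    destruct (Ceq_dec z 0) as [-> | Hz0].
    + exact (proj1 (cseries_Cpow _ _ _) (is_pseries_0 (V := C_NormedModule) (fun n => a (S n)))).
    + apply Cis_series_tail in Hs.
      apply (Cis_series_scal (/ z)%C) in Hs.
      apply (Cis_series_ext _ (fun n => z ^ n * a (S n))%C) in Hs.
      * refine (Cis_series_eq _ _ _ Hs _).
        change (z ^ 0)%C with (RtoC 1); field; exact Hz0.
      * intro n; cbv beta; rewrite Cpow_S; field; exact Hz0.
  - intros z Hz. destruct (Ceq_dec z 0) as [-> | Hz0]; [| field; exact Hz0].
    rewrite (cseries_unique a 0 _ _ (H _ Hz) (is_pseries_0 (V := C_NormedModule) a)); ring.
Qed.

(** * Means over circles *)

(** The second derivative is there to make the first one continuous, as differentiation under the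
    integral sign requires. *)
Definition smooth (U : C -> Prop) (f : C -> C) : Prop :=
  exists f1 f2 : C -> C,
    (forall z, U z -> cderiv f z (f1 z)) /\ (forall z, U z -> cderiv f1 z (f2 z)).

Lemma smooth_const (U : C -> Prop) (a : C) : smooth U (fun _ => a).
Proof.
  exists (fun _ => RtoC 0), (fun _ => RtoC 0); split; intros; apply cderiv_const.
Qed.

Lemma smooth_id (U : C -> Prop) : smooth U (fun z => z).
Proof.
  exists (fun _ => RtoC 1), (fun _ => RtoC 0); split; intros; [apply cderiv_id | apply cderiv_const].
Qed.

Lemma smooth_plus (U : C -> Prop) (f g : C -> C) :
  smooth U f -> smooth U g -> smooth U (fun z => f z + g z)%C.
Proof.
  intros [f1 [f2 [Hf1 Hf2]]] [g1 [g2 [Hg1 Hg2]]].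
  exists (fun z => f1 z + g1 z)%C, (fun z => f2 z + g2 z)%C.
  split; intros; apply cderiv_plus; auto.
Qed.

Lemma smooth_mult (U : C -> Prop) (f g : C -> C) :
  smooth U f -> smooth U g -> smooth U (fun z => f z * g z)%C.
Proof.
  intros [f1 [f2 [Hf1 Hf2]]] [g1 [g2 [Hg1 Hg2]]].
  exists (fun z => f1 z * g z + f z * g1 z)%C; eexists.
  split; intros; [apply cderiv_mult; auto |].
  apply cderiv_plus; apply cderiv_mult; auto.
Qed.

Lemma smooth_minus (U : C -> Prop) (f g : C -> C) :
  smooth U f -> smooth U g -> smooth U (fun z => f z - g z)%C.
Proof.
  intros Hf [g1 [g2 [Hg1 Hg2]]].
  apply smooth_plus; [exact Hf |].
  exists (fun z => - g1 z)%C, (fun z => - g2 z)%C.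
  split; intros; apply cderiv_opp; auto.
Qed.

Lemma smooth_inv (U : C -> Prop) (f : C -> C) :
  smooth U f -> (forall z, U z -> f z <> 0) -> smooth U (fun z => / f z)%C.
Proof.
  intros [f1 [f2 [Hf1 Hf2]]] H0.
  exists (fun z => - f1 z * / f z * / f z)%C; eexists.
  split; intros z Hz; [apply cderiv_inv; auto |].
  assert (Hi : cderiv (fun z => / f z)%C z (- f1 z * / f z * / f z)%C) by (apply cderiv_inv; auto).
  assert (Hn : cderiv (fun w => - f1 w)%C z (- f2 z)%C) by (apply cderiv_opp; auto).
  exact (cderiv_mult _ _ z _ _ (cderiv_mult _ _ z _ _ Hn Hi) Hi).
Qed.

Lemma smooth_cseries (a : nat -> C) (f : C -> C) : cseries_on_disc a f -> smooth in_disc f.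
Proof.
  intro H; destruct (cseries_deriv a f H) as [H1 D1].
  exists (C_derive f), (C_derive (C_derive f)); split; [exact D1 |].
  apply (cseries_deriv _ _ H1).
Qed.

Ltac smooth_expr :=
  first
  [ assumption
  | lazymatch goal with
    | |- smooth ?U (fun z => Cminus (@?f z) (@?g z)) => apply (smooth_minus U f g); smooth_expr
    | |- smooth ?U (fun z => Cplus (@?f z) (@?g z)) => apply (smooth_plus U f g); smooth_expr
    | |- smooth ?U (fun z => Cmult (@?f z) (@?g z)) => apply (smooth_mult U f g); smooth_expr
    | |- smooth ?U (fun z => z) => apply smooth_id
    | |- smooth ?U (fun z => ?a) => apply smooth_const
    end ].

Definition punctured_disc (z : C) : Prop := z <> 0 /\ in_disc z.

Definition circle (r t : R) : C := (r * cos t, r * sin t).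

Lemma Cmod_circle (r t : R) : 0 <= r -> Cmod (circle r t) = r.
Proof.
  intro Hr. unfold Cmod, circle; simpl fst; simpl snd.
  replace ((r * cos t) ^ 2 + (r * sin t) ^ 2) with (r ^ 2 * (Rsqr (sin t) + Rsqr (cos t)))
    by (unfold Rsqr; ring).
  rewrite sin2_cos2, Rmult_1_r; apply sqrt_pow2, Hr.
Qed.

Lemma circle_punctured (r t : R) : 0 < r < 1 -> punctured_disc (circle r t).
Proof.
  intro Hr; split; [apply Cmod_gt_0 | unfold in_disc]; rewrite Cmod_circle; lra.
Qed.

Lemma is_derive_circle_angle (h : C -> C) (l : C) (r t : R) :
  cderiv h (circle r t) l ->
  is_derive (fun s => Re (h (circle r s))) t (Re (Ci * circle r t * l)%C).
Proof.
  intro H.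
  eapply eq_rect with (P := fun d => is_derive _ t d).
  - apply (is_derive_Re_curve h (fun s => r * cos s) (fun s => r * sin s) t
      (- (r * sin t)) (r * cos t) l); [auto_derive; [exact I | ring] .. | exact H].
  - unfold circle, Ci; destruct l; simpl; ring.
Qed.

Lemma is_derive_circle_radius (h : C -> C) (l : C) (r t : R) :
  cderiv h (circle r t) l ->
  is_derive (fun s => Re (h (circle s t))) r (Re (circle 1 t * l)%C).
Proof.
  intro H.
  eapply eq_rect with (P := fun d => is_derive _ r d).
  - apply (is_derive_Re_curve h (fun s => s * cos t) (fun s => s * sin t) r
      (cos t) (sin t) l); [auto_derive; [exact I | ring] .. | exact H].
  - unfold circle; rewrite !Rmult_1_l; reflexivity.
Qed.

Lemma continuous_Re_circle (h : C -> C) (l : C) (r t : R) :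
  cderiv h (circle r t) l -> continuous (fun s => Re (h (circle r s))) t.
Proof.
  intro H; apply (ex_derive_continuous (V := R_NormedModule)).
  eexists; apply (is_derive_circle_angle _ _ _ _ H).
Qed.

(* [z h'(z)] is the angular derivative of [- i h]. *)
Lemma is_RInt_angular_derivative (h h1 : C -> C) (r : R) :
  (forall z, punctured_disc z -> cderiv h z (h1 z)) ->
  (forall z, punctured_disc z -> exists l, cderiv h1 z l) ->
  0 < r < 1 ->
  is_RInt (fun t => Re (circle r t * h1 (circle r t))%C) 0 (2 * PI) 0.
Proof.
  intros H1 H2 Hr.
  set (F := fun t => Re (- Ci * h (circle r t))%C).
  replace 0 with (minus (F (2 * PI)) (F 0)) at 2.
  2:{ unfold F, circle. rewrite cos_2PI, sin_2PI, cos_0, sin_0.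
      unfold minus, plus, opp; simpl; ring. }
  apply (is_RInt_derive (V := R_CompleteNormedModule)); intros t _.
  - pose proof (circle_punctured r t Hr) as Hp.
    pose proof (is_derive_circle_angle (fun z => - Ci * h z)%C _ r t
      (cderiv_scal (- Ci)%C _ _ _ (H1 _ Hp))) as D.
    refine (eq_rect _ (fun d => is_derive _ t d) D _ _).
    destruct (h1 (circle r t)), (h (circle r t)), (circle r t); simpl; ring.
  - pose proof (circle_punctured r t Hr) as Hp.
    destruct (H2 _ Hp) as [l Hl].
    apply (continuous_Re_circle (fun z => z * h1 z)%C _ r t
      (cderiv_mult _ _ _ _ _ (cderiv_id _) Hl)).
Qed.

Lemma continuity_2d_Re_circle (h : C -> C) (l : C) (r t : R) :
  cderiv h (circle r t) l -> continuity_2d_pt (fun u v => Re (h (circle u v))) r t.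
Proof.
  intros H eps.
  destruct (cderiv_continuous h _ l eps H (cond_pos eps)) as [d [Hd Hw]].
  assert (Hd2 : 0 < d / 2) by lra.
  assert (Cc : continuity_2d_pt (fun u v => u * cos v) r t).
  { apply continuity_2d_pt_mult; [apply continuity_2d_pt_id1 |].
    apply (continuity_1d_2d_pt_comp cos (fun _ v => v));
      [apply continuity_cos | apply continuity_2d_pt_id2]. }
  assert (Cs : continuity_2d_pt (fun u v => u * sin v) r t).
  { apply continuity_2d_pt_mult; [apply continuity_2d_pt_id1 |].
    apply (continuity_1d_2d_pt_comp sin (fun _ v => v));
      [apply continuity_sin | apply continuity_2d_pt_id2]. }
  specialize (Cc (mkposreal _ Hd2)); specialize (Cs (mkposreal _ Hd2)).
  pose proof (locally_2d_and _ _ _ _ Cc Cs) as K.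
  revert K; apply locally_2d_impl, locally_2d_forall; intros u v [K1 K2]; simpl in K1, K2.
  eapply Rle_lt_trans; [| apply (Hw (circle u v))].
  - eapply Rle_trans; [| apply re_le_Cmod]. apply Req_le; reflexivity.
  - eapply Rle_lt_trans; [apply Cmod_le_abs |].
    change (Rabs (u * cos v - r * cos t) + Rabs (u * sin v - r * sin t) < d); lra.
Qed.

Lemma locally_open_unit (r : R) : 0 < r < 1 -> locally r (fun s => 0 < s < 1).
Proof.
  intro Hr. apply (locally_open (fun s => 0 < s < 1)); [| auto | exact Hr].
  apply open_and; [apply open_gt | apply open_lt].
Qed.

(** Differentiating under the integral, the radial derivative at radius [r] is [Re (z h'(z)) / r],
    whose integral over the circle vanishes by [is_RInt_angular_derivative]. *)
Lemma is_derive_circle_mean (h h1 : C -> C) (r : R) :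
  (forall z, punctured_disc z -> cderiv h z (h1 z)) ->
  (forall z, punctured_disc z -> exists l, cderiv h1 z l) ->
  0 < r < 1 ->
  is_derive (fun s => RInt (fun t => Re (h (circle s t))) 0 (2 * PI)) r 0.
Proof.
  intros H1 H2 Hr.
  pose proof (locally_open_unit r Hr) as Lr.
  assert (E : forall s t, 0 < s < 1 ->
    Derive (fun u => Re (h (circle u t))) s = Re (circle s t * h1 (circle s t))%C * / s).
  { intros s t Hs. apply is_derive_unique.
    refine (eq_rect _ (fun d => is_derive _ s d)
      (is_derive_circle_radius h _ s t (H1 _ (circle_punctured s t Hs))) _ _).
    unfold circle; destruct (h1 _); simpl; field; lra. }
  assert (D := is_derive_RInt_param (fun s t => Re (h (circle s t))) 0 (2 * PI) r).
  refine (eq_rect _ (fun d => is_derive _ r d) (D _ _ _) _ _).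
  - revert Lr; apply filter_imp; intros s Hs t _.
    eexists; apply (is_derive_circle_radius h _ s t (H1 _ (circle_punctured s t Hs))).
  - intros t _.
    apply (continuity_2d_pt_ext_loc (fun s t => Re (circle s t * h1 (circle s t))%C * / s)).
    { destruct Lr as [d Hd]; exists d; intros u v Hu _; symmetry; apply E, Hd, Hu. }
    destruct (H2 _ (circle_punctured r t Hr)) as [l Hl].
    apply continuity_2d_pt_mult.
    + apply (continuity_2d_Re_circle (fun z => z * h1 z)%C _ r t
        (cderiv_mult _ _ _ _ _ (cderiv_id _) Hl)).
    + apply continuity_2d_pt_inv; [apply continuity_2d_pt_id1 | lra].
  - revert Lr; apply filter_imp; intros s Hs.
    apply (ex_RInt_continuous (V := R_CompleteNormedModule)); intros t _.
    apply (continuous_Re_circle h _ s t (H1 _ (circle_punctured s t Hs))).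
  - rewrite (RInt_ext _ (fun t => scal (/ r) (Re (circle r t * h1 (circle r t))%C))).
    2:{ intros t _. rewrite E by exact Hr. unfold scal; simpl; unfold mult; simpl; ring. }
    pose proof (is_RInt_scal _ _ _ (/ r) _ (is_RInt_angular_derivative h h1 r H1 H2 Hr)) as K.
    etransitivity; [exact (is_RInt_unique _ _ _ _ K) | apply Rmult_0_r].
Qed.

(** The integral does not depend on the radius, and continuity at 0 makes it arbitrarily close to
    [2 PI Re (h 0)] on small circles. *)
Lemma mean_value (h : C -> C) (r : R) :
  smooth in_disc h -> 0 < r < 1 ->
  is_RInt (fun t => Re (h (circle r t))) 0 (2 * PI) (2 * PI * Re (h 0)).
Proof.
  intros [h1 [h2 [H1 H2]]] Hr.
  assert (P1 : forall z, punctured_disc z -> cderiv h z (h1 z)) by (intros z [_ Hz]; auto).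
  assert (P2 : forall z, punctured_disc z -> exists l, cderiv h1 z l) by (intros z [_ Hz]; eauto).
  set (M := fun s => RInt (fun t => Re (h (circle s t))) 0 (2 * PI)).
  assert (EX : forall s, 0 < s < 1 -> ex_RInt (fun t => Re (h (circle s t))) 0 (2 * PI)).
  { intros s Hs. apply (ex_RInt_continuous (V := R_CompleteNormedModule)); intros t _.
    apply (continuous_Re_circle h _ s t (P1 _ (circle_punctured s t Hs))). }
  pose proof PI_RGT_0 as Hpi.
  assert (E : M r = 2 * PI * Re (h 0)).
  { apply Rminus_diag_uniq, Rabs_eq_0, Rle_antisym; [| apply Rabs_pos].
    apply le_epsilon; intros eps He; rewrite Rplus_0_l.
    assert (H0 : in_disc 0) by (unfold in_disc; rewrite Cmod_0; lra).
    assert (He' : 0 < eps / (2 * PI)) by (apply Rdiv_lt_0_compat; lra).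
    destruct (cderiv_continuous h 0 _ _ (H1 _ H0) He') as [d [Hd Hw]].
    set (s := Rmin (d / 2) (r / 2)).
    assert (Hs : 0 < s < r /\ s < d).
    { unfold s; split; [split |].
      - apply Rmin_pos; lra.
      - pose proof (Rmin_r (d / 2) (r / 2)); lra.
      - pose proof (Rmin_l (d / 2) (r / 2)); lra. }
    assert (Ms : M s = M r).
    { apply (eq_is_derive (V := R_NormedModule) M); [| lra].
      intros u Hu; apply (is_derive_circle_mean h h1 u P1 P2); lra. }
    rewrite <- Ms; unfold M.
    assert (Hs1 : 0 < s < 1) by lra.
    pose proof (RInt_correct _ _ _ (EX s Hs1)) as I1.
    pose proof (is_RInt_minus _ _ _ _ _ _ I1 (is_RInt_const 0 (2 * PI) (Re (h 0)))) as I2.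
    pose proof (is_RInt_unique _ _ _ _ I2) as I3.
    assert (B : Rabs (RInt (fun t => minus (Re (h (circle s t))) (Re (h 0))) 0 (2 * PI))
                <= (2 * PI - 0) * (eps / (2 * PI))).
    { apply abs_RInt_le_const; [lra | eexists; exact I2 |].
      intros t _. left; eapply Rle_lt_trans; [| apply (Hw (circle s t))].
      - eapply Rle_trans; [| apply re_le_Cmod]. apply Req_le; reflexivity.
      - unfold Cminus; rewrite Copp_0, Cplus_0_r, Cmod_circle; lra. }
    rewrite Rminus_0_r in B.
    replace (2 * PI * (eps / (2 * PI))) with eps in B by (field; lra).
    refine (Rle_trans _ _ _ (Req_le _ _ _) B). f_equal.
    refine (eq_trans _ (eq_sym I3)).
    unfold minus, plus, opp, scal; simpl; unfold mult; simpl. unfold Rminus. rewrite Ropp_0, Rplus_0_r.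
    reflexivity. }
  exact (eq_rect _ (fun v => is_RInt _ _ _ v) (RInt_correct _ _ _ (EX r Hr)) _ E).
Qed.

Lemma cderiv_inv_pow (m : nat) (z : C) :
  z <> 0 -> cderiv (fun w => (/ w) ^ m)%C z (- INR m * (/ z) ^ S m)%C.
Proof.
  intro Hz; induction m as [| m IH].
  - eapply cderiv_eq; [apply (cderiv_const 1) | simpl; ring].
  - eapply cderiv_eq;
      [exact (cderiv_mult _ _ z _ _ (cderiv_inv _ z _ (cderiv_id z) Hz) IH) |].
    cbv beta; rewrite S_INR, RtoC_plus, !Cpow_S; ring.
Qed.

Lemma mean_neg_power (k : C) (m : nat) (r : R) :
  (0 < m)%nat -> 0 < r < 1 ->
  is_RInt (fun t => Re (k * (/ circle r t) ^ m)%C) 0 (2 * PI) 0.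
Proof.
  intros Hm Hr.
  assert (Hm0 : RtoC (INR m) <> 0).
  { intro E; apply RtoC_inj in E. apply lt_0_INR in Hm; lra. }
  (* The function [c z^(-m)] satisfies [z h'(z) = k z^(-m)], so its angular derivative provides the
     integrand. *)
  set (c := (- k / INR m)%C).
  pose proof (is_RInt_angular_derivative (fun z => c * (/ z) ^ m)%C
    (fun z => c * (- INR m * (/ z) ^ S m))%C r) as K.
  eapply is_RInt_ext; [| apply K; [| | exact Hr]].
  - intros t _; cbv beta. f_equal.
    rewrite Cpow_S; unfold c; field; split; [apply circle_punctured, Hr | exact Hm0].
  - intros z [Hz _]. apply cderiv_scal, cderiv_inv_pow, Hz.
  - intros z [Hz _]. eexists. do 2 apply cderiv_scal. apply cderiv_inv_pow, Hz.
Qed.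

Lemma laurent_mean_nonneg (h E : C -> C) (l1 l2 l3 : C) (r : R) :
  0 < r < 1 -> smooth in_disc E ->
  (forall z, punctured_disc z ->
     h z = (E z + l1 * (/ z) ^ 1 + l2 * (/ z) ^ 2 + l3 * (/ z) ^ 3)%C) ->
  (forall t, 0 <= Re (h (circle r t))) ->
  0 <= Re (E 0).
Proof.
  intros Hr HE Hh Hpos.
  pose proof PI_RGT_0 as Hpi.
  pose proof (is_RInt_plus _ _ _ _ _ _ (is_RInt_plus _ _ _ _ _ _ (is_RInt_plus _ _ _ _ _ _
    (mean_value E r HE Hr) (mean_neg_power l1 1 r ltac:(auto) Hr))
    (mean_neg_power l2 2 r ltac:(auto) Hr)) (mean_neg_power l3 3 r ltac:(auto) Hr)) as HI.
  assert (P : 0 <= plus (plus (plus (2 * PI * Re (E 0)) 0) 0) 0).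
  { eapply (is_RInt_le (fun _ => 0) _ 0 (2 * PI)); [lra | | exact HI |].
    - pose proof (is_RInt_const 0 (2 * PI) 0) as K.
      refine (eq_rect _ (is_RInt _ _ _) K _ _). apply Rmult_0_r.
    - intros t _. eapply Rle_trans; [apply (Hpos t) |]. apply Req_le.
      rewrite (Hh _ (circle_punctured r t Hr)); reflexivity. }
  unfold plus in P; simpl in P. nra.
Qed.

Lemma Re_RtoC_mult (x : R) (z : C) : Re (x * z)%C = x * Re z.
Proof. destruct z; simpl; ring. Qed.

Lemma Re_sqr_dist_nonneg (x y : C) (m : R) :
  Cmod x ^ 2 <= m -> 0 <= m + Cmod y ^ 2 - 2 * Re (x * Cconj y)%C.
Proof.
  intro H. pose proof (pow2_ge_0 (Cmod (x - y))) as K.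
  rewrite !Cmod2_alt in *. destruct x, y; simpl in *. lra.
Qed.

(* Expanding [|omega g - V|^2 >= 0] on [|z| = r], where [V] is the Taylor polynomial of
   [omega g] of degree 3; there [conj z = r^2 / z] makes every term the real part of a
   Laurent series, whose mean is its constant coefficient. *)
Lemma bessel_on_circle (omega rem : C -> C) (b0 b1 b2 b3 w0 w1 w2 w3 : C) (r : R) :
  (forall z, in_disc z -> Cmod (z * omega z) <= 1) ->
  smooth in_disc rem ->
  (forall z, in_disc z ->
     omega z = (b0 + b1 * z + b2 * z ^ 2 + b3 * z ^ 3 + z ^ 4 * rem z)%C) ->
  0 < r < 1 ->
  Cmod (b0 * w0) ^ 2 + Cmod (b1 * w0 + b0 * w1) ^ 2 * r ^ 2
    + Cmod (b2 * w0 + b1 * w1 + b0 * w2) ^ 2 * r ^ 4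
    + Cmod (b3 * w0 + b2 * w1 + b1 * w2 + b0 * w3) ^ 2 * r ^ 6
  <= (Cmod w0 ^ 2 + Cmod w1 ^ 2 * r ^ 2 + Cmod w2 ^ 2 * r ^ 4 + Cmod w3 ^ 2 * r ^ 6) / r ^ 2.
Proof.
  intros Hb Hrem Hom Hr.
  set (v0 := (b0 * w0)%C). set (v1 := (b1 * w0 + b0 * w1)%C).
  set (v2 := (b2 * w0 + b1 * w1 + b0 * w2)%C).
  set (v3 := (b3 * w0 + b2 * w1 + b1 * w2 + b0 * w3)%C).
  (* Coefficients in powers of [1 / z] chosen so that, on the circle, [gs = conj g / r^2] and
     [Vs = conj V]. *)
  set (p0 := (Cconj w0 / r ^ 2)%C). set (p1 := Cconj w1).
  set (p2 := (Cconj w2 * r ^ 2)%C). set (p3 := (Cconj w3 * r ^ 4)%C).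
  set (q0 := Cconj v0). set (q1 := (Cconj v1 * r ^ 2)%C).
  set (q2 := (Cconj v2 * r ^ 4)%C). set (q3 := (Cconj v3 * r ^ 6)%C).
  set (g := fun z : C => (w0 + w1 * z + w2 * z ^ 2 + w3 * z ^ 3)%C).
  set (V := fun z : C => (v0 + v1 * z + v2 * z ^ 2 + v3 * z ^ 3)%C).
  set (gs := fun z : C => (p0 + p1 * / z + p2 * (/ z) ^ 2 + p3 * (/ z) ^ 3)%C).
  set (Vs := fun z : C => (q0 + q1 * / z + q2 * (/ z) ^ 2 + q3 * (/ z) ^ 3)%C).
  (* [Q] is defined by [omega g = V + z^4 Q]. Powers are written as products for [smooth_expr]. *)
  set (Q := fun z : C => (rem z * (w0 + w1 * z + w2 * (z * z) + w3 * (z * (z * z)))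
     + ((b1 * w3 + b2 * w2 + b3 * w1) + (b2 * w3 + b3 * w2) * z + b3 * w3 * (z * z)))%C).
  (* The part without negative powers of [z] in [g gs - V Vs - 2 z^4 Q Vs]. Since [z^4 Vs] is a
     polynomial divisible by [z], the last term does not contribute to [E 0]. *)
  set (E := fun z : C =>
     ((w0 * p0 + w1 * p1 + w2 * p2 + w3 * p3 - (v0 * q0 + v1 * q1 + v2 * q2 + v3 * q3))
      + (w1 * p0 + w2 * p1 + w3 * p2 - (v1 * q0 + v2 * q1 + v3 * q2)) * z
      + (w2 * p0 + w3 * p1 - (v2 * q0 + v3 * q1)) * (z * z)
      + (w3 * p0 - v3 * q0) * (z * (z * z))
      - 2 * (z * (q3 + q2 * z + q1 * (z * z) + q0 * (z * (z * z))) * Q z))%C).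
  assert (HR : (r <> 0 :> C)%C) by (intro K; apply RtoC_inj in K; lra).
  pose proof (laurent_mean_nonneg
    (fun z => g z * gs z + V z * Vs z - 2 * (omega z * g z * Vs z))%C E
    (w0 * p1 + w1 * p2 + w2 * p3 - (v0 * q1 + v1 * q2 + v2 * q3))
    (w0 * p2 + w1 * p3 - (v0 * q2 + v1 * q3)) (w0 * p3 - v0 * q3) r Hr) as L.
  assert (L0 : 0 <= Re (E 0)).
  { apply L; clear L.
    - unfold E, Q; smooth_expr.
    - intros z [Hz Hz1]. rewrite (Hom z Hz1).
      unfold g, gs, V, Vs, E, Q, v0, v1, v2, v3. clearbody p0 p1 p2 p3 q0 q1 q2 q3.
      field; exact Hz.
    - intro t. set (z := circle r t).
      destruct (circle_punctured r t Hr) as [Hz Hz1]; fold z in Hz, Hz1.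
      assert (Hzm : Cmod z = r) by (apply Cmod_circle; lra).
      assert (Hc : (/ z)%C = (Cconj z / r ^ 2)%C).
      { replace (r ^ 2)%C with (z * Cconj z)%C.
        - field; split; [| exact Hz]. intro K; apply Hz, Cmod_eq_0.
          rewrite <- Cmod_conj, K; apply Cmod_0.
        - rewrite <- Cmod2_conj, Hzm, RtoC_pow; reflexivity. }
      assert (Hg : gs z = (Cconj (g z) / r ^ 2)%C).
      { unfold gs, g, p0, p1, p2, p3. rewrite Hc, !Cplus_conj, !Cmult_conj, !Cpow_conj.
        field; exact HR. }
      assert (HV : Vs z = Cconj (V z)).
      { unfold Vs, V, q0, q1, q2, q3. rewrite Hc, !Cplus_conj, !Cmult_conj, !Cpow_conj.
        field; exact HR. }
      rewrite Hg, HV.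
      replace (g z * (Cconj (g z) / r ^ 2) + V z * Cconj (V z) - 2 * (omega z * g z * Cconj (V z)))%C
        with (RtoC (Cmod (g z) ^ 2 / r ^ 2 + Cmod (V z) ^ 2) - RtoC 2 * (omega z * g z * Cconj (V z)))%C.
      2:{ rewrite RtoC_plus, RtoC_div, !Cmod2_conj, RtoC_pow by (apply pow_nonzero; lra).
          field; exact HR. }
      replace (Re _) with (Cmod (g z) ^ 2 / r ^ 2 + Cmod (V z) ^ 2
                            - 2 * Re (omega z * g z * Cconj (V z))%C).
      2:{ rewrite <- Re_RtoC_mult; reflexivity. }
      apply Re_sqr_dist_nonneg.
      (* From [r |omega| <= 1] follows [|omega g|^2 <= |g|^2 / r^2]. *)
      specialize (Hb z Hz1); rewrite Cmod_mult, Hzm in Hb.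
      rewrite Cmod_mult. apply (Rle_div_r _ _ (r ^ 2)); [apply pow_lt; lra |].
      pose proof (Cmod_ge_0 (omega z)). pose proof (Cmod_ge_0 (g z)).
      replace ((Cmod (omega z) * Cmod (g z)) ^ 2 * r ^ 2)
        with ((r * Cmod (omega z)) ^ 2 * Cmod (g z) ^ 2) by ring.
      rewrite <- (Rmult_1_l (Cmod (g z) ^ 2)) at 2.
      apply Rmult_le_compat_r; [apply pow2_ge_0 |].
      rewrite <- (pow1 2). apply pow_incr; split; [apply Rmult_le_pos; lra | exact Hb]. }
  assert (E0 : E 0 = RtoC ((Cmod w0 ^ 2 + Cmod w1 ^ 2 * r ^ 2 + Cmod w2 ^ 2 * r ^ 4
      + Cmod w3 ^ 2 * r ^ 6) / r ^ 2
    - (Cmod v0 ^ 2 + Cmod v1 ^ 2 * r ^ 2 + Cmod v2 ^ 2 * r ^ 4 + Cmod v3 ^ 2 * r ^ 6))).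
  { rewrite RtoC_minus, RtoC_div, !RtoC_plus, !RtoC_mult, !Cmod2_conj, !RtoC_pow
      by (apply pow_nonzero; lra).
    unfold E, p0, p1, p2, p3, q0, q1, q2, q3. field; exact HR. }
  rewrite E0 in L0; simpl in L0. simpl. lra.
Qed.

(** The limit [r -> 1] of [bessel_on_circle], carried out by contradiction at one explicit
    radius. *)
Lemma contraction_of_bounded (omega rem : C -> C) (b0 b1 b2 b3 : C) :
  (forall z, in_disc z -> Cmod (z * omega z) <= 1) ->
  smooth in_disc rem ->
  (forall z, in_disc z ->
     omega z = (b0 + b1 * z + b2 * z ^ 2 + b3 * z ^ 3 + z ^ 4 * rem z)%C) ->
  contraction4 b0 b1 b2 b3.
Proof.
  intros Hb Hrem Hom w0 w1 w2 w3.
  pose proof (fun r => bessel_on_circle omega rem b0 b1 b2 b3 w0 w1 w2 w3 r Hb Hrem Hom) as B.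
  pose proof (pow2_ge_0 (Cmod (b0 * w0))) as P0.
  pose proof (pow2_ge_0 (Cmod (b1 * w0 + b0 * w1))) as P1.
  pose proof (pow2_ge_0 (Cmod (b2 * w0 + b1 * w1 + b0 * w2))) as P2.
  pose proof (pow2_ge_0 (Cmod (b3 * w0 + b2 * w1 + b1 * w2 + b0 * w3))) as P3.
  pose proof (pow2_ge_0 (Cmod w0)) as S0. pose proof (pow2_ge_0 (Cmod w1)) as S1.
  pose proof (pow2_ge_0 (Cmod w2)) as S2. pose proof (pow2_ge_0 (Cmod w3)) as S3.
  set (A0 := Cmod (b0 * w0) ^ 2) in *. set (A1 := Cmod (b1 * w0 + b0 * w1) ^ 2) in *.
  set (A2 := Cmod (b2 * w0 + b1 * w1 + b0 * w2) ^ 2) in *.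
  set (A3 := Cmod (b3 * w0 + b2 * w1 + b1 * w2 + b0 * w3) ^ 2) in *.
  set (W0 := Cmod w0 ^ 2) in *. set (W1 := Cmod w1 ^ 2) in *.
  set (W2 := Cmod w2 ^ 2) in *. set (W3 := Cmod w3 ^ 2) in *.
  clearbody A0 A1 A2 A3 W0 W1 W2 W3.
  remember (A0 + A1 + A2 + A3) as A eqn:EA; remember (W0 + W1 + W2 + W3) as W eqn:EW.
  apply Rnot_lt_le; intro Hlt.
  assert (HA : 0 < A) by lra.
  (* Chosen so that [A r^8 >= A (1 - 8 d) = (A + W) / 2 > W], while the inequality on the circle
     gives [A r^8 <= W]. *)
  set (d := (A - W) / (16 * A)).
  assert (Ed : d * (16 * A) = A - W) by (unfold d; field; lra).
  assert (Hd : 0 < d <= 1 / 16) by (split; nra).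
  set (r := 1 - d).
  assert (Hr : 0 < r < 1) by (unfold r; lra).
  specialize (B r Hr). apply (Rle_div_r _ _ (r ^ 2)) in B; [| apply pow_lt; lra].
  assert (r2 : 0 < r ^ 2 <= 1) by (split; nra).
  assert (r4 : 0 <= r ^ 4 <= 1) by (replace (r ^ 4) with (r ^ 2 * r ^ 2) by ring; nra).
  assert (r6 : 0 <= r ^ 6 <= 1) by (replace (r ^ 6) with (r ^ 2 * r ^ 4) by ring; nra).
  assert (L2 : 1 - 2 * d <= r ^ 2) by (unfold r; nra).
  assert (L4 : 1 - 4 * d <= r ^ 4) by (replace (r ^ 4) with (r ^ 2 * r ^ 2) by ring; nra).
  assert (L8 : 1 - 8 * d <= r ^ 8) by (replace (r ^ 8) with (r ^ 4 * r ^ 4) by ring; nra).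
  assert (U6 : r ^ 8 <= r ^ 6) by (replace (r ^ 8) with (r ^ 2 * r ^ 6) by ring; nra).
  assert (U4 : r ^ 6 <= r ^ 4) by (replace (r ^ 6) with (r ^ 2 * r ^ 4) by ring; nra).
  assert (U2 : r ^ 4 <= r ^ 2) by (replace (r ^ 4) with (r ^ 2 * r ^ 2) by ring; nra).
  assert (X : A * r ^ 8 <= W).
  { replace ((A0 + A1 * r ^ 2 + A2 * r ^ 4 + A3 * r ^ 6) * r ^ 2)
      with (A0 * r ^ 2 + A1 * r ^ 4 + A2 * r ^ 6 + A3 * r ^ 8) in B by ring.
    nra. }
  nra.
Qed.

(** * Starlike functions *)

Lemma cderiv_ext_disc (f g : C -> C) (z l : C) :
  (forall w, in_disc w -> f w = g w) -> in_disc z -> cderiv f z l -> cderiv g z l.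
Proof.
  intros E Hz H; apply cderiv_intro; intros eps He.
  destruct (cderiv_elim f z l eps H He) as [d [Hd Hw]].
  exists (Rmin d (1 - Cmod z)); split; [apply Rmin_pos; unfold in_disc in Hz; lra |].
  intros w Bw.
  assert (in_disc w).
  { pose proof (Cmod_triangle (w - z) z) as T. replace (w - z + z)%C with w in T by ring.
    pose proof (Rmin_r d (1 - Cmod z)). unfold in_disc; lra. }
  rewrite <- !E by assumption.
  apply Hw; eapply Rlt_le_trans; [exact Bw | apply Rmin_l].
Qed.

Lemma cseries_at_0 (a : nat -> C) (f : C -> C) : cseries_on_disc a f -> f 0 = a 0%nat.
Proof.
  intro H. apply (cseries_unique a 0); [| exact (is_pseries_0 (V := C_NormedModule) a)].
  apply H; unfold in_disc; rewrite Cmod_0; lra.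
Qed.

Lemma cseries_taylor4 (a : nat -> C) (f : C -> C) :
  cseries_on_disc a f ->
  exists g, smooth in_disc g /\ forall z, in_disc z ->
    f z = (a 0%nat + a 1%nat * z + a 2%nat * z ^ 2 + a 3%nat * z ^ 3 + z ^ 4 * g z)%C.
Proof.
  intro H.
  destruct (cseries_tail _ _ H) as [g1 [H1 E1]]. destruct (cseries_tail _ _ H1) as [g2 [H2 E2]].
  destruct (cseries_tail _ _ H2) as [g3 [H3 E3]]. destruct (cseries_tail _ _ H3) as [g4 [H4 E4]].
  exists g4; split; [exact (smooth_cseries _ _ H4) |].
  intros z Hz; rewrite E1, E2, E3, E4 by exact Hz; ring.
Qed.

(** The half plane [Re m > - b] consists of the points closer to 0 than to [- 2 b]. *)
Lemma Cmod_Cayley (m : C) (b : R) :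
  0 < b -> - b < Re m -> (2 * b + m <> 0)%C /\ Cmod m <= Cmod (2 * b + m).
Proof.
  intros Hb Hm; split.
  - intro E. assert (Er : Re (2 * b + m)%C = 0) by (rewrite E; reflexivity).
    destruct m; simpl in *; lra.
  - assert (H : Cmod m ^ 2 <= Cmod (2 * b + m) ^ 2).
    { rewrite !Cmod2_alt; destruct m; simpl in *; nra. }
    pose proof (Cmod_ge_0 m). pose proof (Cmod_ge_0 (2 * b + m)). nra.
Qed.

(** With [f = z g] and [m = z g' / g], starlikeness reads [Re m > - beta], and
    [z omega = m / (2 beta + m)] is bounded by 1 by [Cmod_Cayley]. The Taylor coefficients of
    [omega] are the required [b0], ..., [b3]. *)
Lemma starlike_schur (alpha : R) (f : C -> C) (a : nat -> C) :
  0 <= alpha < 1 -> starlike alpha f -> normalized_expansion f a ->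
  exists b0 b1 b2 b3 : C, contraction4 b0 b1 b2 b3 /\
    let b := RtoC (1 - alpha) in
    (a 2%nat = 2 * b * b0)%C /\
    (2 * a 3%nat = 2 * b * b1 + (2 * b + 1) * a 2%nat * b0)%C /\
    (3 * a 4%nat = 2 * b * b2 + (2 * b + 1) * a 2%nat * b1 + (2 * b + 2) * a 3%nat * b0)%C /\
    (4 * a 5%nat = 2 * b * b3 + (2 * b + 1) * a 2%nat * b2 + (2 * b + 2) * a 3%nat * b1
                   + (2 * b + 3) * a 4%nat * b0)%C.
Proof.
  intros Ha [_ [Hnz Hre]] [A0 [A1 Hf]].
  set (beta := 1 - alpha). assert (Hbeta : 0 < beta) by (unfold beta; lra).
  change (cseries_on_disc a f) in Hf.
  destruct (cseries_deriv _ _ Hf) as [_ Df].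
  destruct (cseries_tail _ _ Hf) as [g [Hg Eg]].
  assert (Fg : forall z, in_disc z -> f z = (z * g z)%C)
    by (intros z Hz; rewrite Eg, A0 by exact Hz; ring).
  destruct (cseries_deriv _ _ Hg) as [Hg1 Dg].
  set (g1 := C_derive g) in *.
  assert (g_nz : forall z, in_disc z -> g z <> 0).
  { intros z Hz E. destruct (Ceq_dec z 0) as [-> | Hz0].
    - rewrite (cseries_at_0 _ _ Hg), A1 in E. apply RtoC_inj in E; lra.
    - apply (Hnz z Hz Hz0). rewrite Fg, E by exact Hz; ring. }
  assert (Hm : forall z, in_disc z -> - beta < Re (z * g1 z / g z)%C).
  { intros z Hz. specialize (Hre z Hz). unfold starlike_quotient in Hre.
    destruct (Ceq_dec z 0) as [-> | Hz0].
    - unfold Cdiv; rewrite !Cmult_0_l; simpl; lra.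
    - assert (Ed : C_derive f z = (g z + z * g1 z)%C).
      { apply cderiv_unique.
        apply (cderiv_ext_disc (fun w => w * g w)%C); [| exact Hz |].
        - intros w Hw; symmetry; apply Fg, Hw.
        - eapply cderiv_eq; [exact (cderiv_mult _ _ z _ _ (cderiv_id z) (Dg z Hz)) | cbv beta; ring]. }
      rewrite Ed, Fg in Hre by exact Hz.
      replace (z * (g z + z * g1 z) / (z * g z))%C with (1 + z * g1 z / g z)%C in Hre
        by (field; auto).
      unfold beta. simpl in *. lra. }
  set (D := fun z => (2 * beta * g z + z * g1 z)%C).
  assert (D_nz : forall z, in_disc z -> D z <> 0).
  { intros z Hz.
    replace (D z) with (g z * (2 * beta + z * g1 z / g z))%C by (unfold D; field; auto).
    apply Cmult_neq_0; [auto | apply Cmod_Cayley; auto]. }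
  destruct (cseries_taylor4 _ _ Hg) as [g4 [Sg4 Eg4]].
  destruct (cseries_taylor4 _ _ Hg1) as [n4 [Sn4 En4]].
  assert (Hn : forall k, coeffs_deriv (fun n => a (S n)) k = (INR (S k) * a (S (S k)))%C) by reflexivity.
  rewrite A1 in Eg4.
  setoid_rewrite Hn in En4.
  (* [d1], [d2], [d3] are the Taylor coefficients of [D] after [2 beta]; the [b]'s below come from
     long division of [g'] by [D]. *)
  set (d1 := ((2 * beta + 1) * a 2%nat)%C). set (d2 := ((2 * beta + 2) * a 3%nat)%C).
  set (d3 := ((2 * beta + 3) * a 4%nat)%C).
  set (D4 := fun z => (2 * beta * g4 z + 4 * a 5%nat + z * n4 z)%C).
  assert (ED : forall z, in_disc z ->
    D z = (2 * beta + d1 * z + d2 * z ^ 2 + d3 * z ^ 3 + z ^ 4 * D4 z)%C).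
  { intros z Hz. unfold D. rewrite Eg4, En4 by exact Hz. simpl INR. rewrite !RtoC_plus.
    unfold d1, d2, d3, D4. ring. }
  assert (Hb0 : RtoC beta <> 0) by (intro E; apply RtoC_inj in E; lra).
  set (b0 := (a 2%nat / (2 * beta))%C).
  set (b1 := ((2 * a 3%nat - d1 * b0) / (2 * beta))%C).
  set (b2 := ((3 * a 4%nat - d1 * b1 - d2 * b0) / (2 * beta))%C).
  set (b3 := ((4 * a 5%nat - d1 * b2 - d2 * b1 - d3 * b0) / (2 * beta))%C).
  assert (E0 : (a 2%nat = 2 * beta * b0)%C) by (unfold b0; field; exact Hb0).
  assert (E1 : (2 * a 3%nat = 2 * beta * b1 + d1 * b0)%C) by (unfold b1; field; exact Hb0).
  assert (E2 : (3 * a 4%nat = 2 * beta * b2 + d1 * b1 + d2 * b0)%C) by (unfold b2; field; exact Hb0).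
  assert (E3 : (4 * a 5%nat = 2 * beta * b3 + d1 * b2 + d2 * b1 + d3 * b0)%C)
    by (unfold b3; field; exact Hb0).
  exists b0, b1, b2, b3; split; [| cbv zeta; fold beta; repeat split; assumption].
  clearbody b0 b1 b2 b3.
  (* What remains of [g1 - (b0 + b1 z + b2 z^2 + b3 z^3) D] after cancelling the powers below [z^4],
     divided by [z^4 D]. *)
  set (rem := fun z => ((n4 z - D4 z * (b0 + b1 * z + b2 * (z * z) + b3 * (z * (z * z)))
     - (d1 * b3 + d2 * b2 + d3 * b1 + (d2 * b3 + d3 * b2) * z + d3 * b3 * (z * z))) * / D z)%C).
  apply (contraction_of_bounded (fun z => g1 z / D z)%C rem).
  - intros z Hz.
    destruct (Cmod_Cayley (z * g1 z / g z) beta Hbeta (Hm z Hz)) as [N0 NC].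
    replace (z * (g1 z / D z))%C with ((z * g1 z / g z) / (2 * beta + z * g1 z / g z))%C
      by (unfold D; field; repeat split; auto; apply D_nz, Hz).
    rewrite Cmod_div by exact N0.
    apply Rle_div_l; [apply Cmod_gt_0, N0 | lra].
  - pose proof (smooth_cseries _ _ Hg) as Sg. pose proof (smooth_cseries _ _ Hg1) as Sg1.
    assert (SD : smooth in_disc D) by (unfold D; smooth_expr).
    pose proof (smooth_inv _ _ SD D_nz) as SI.
    unfold rem, D4. smooth_expr.
  - intros z Hz.
    assert (EN : g1 z = ((b0 + b1 * z + b2 * z ^ 2 + b3 * z ^ 3) * D z + z ^ 4 * (rem z * D z))%C).
    { unfold rem. rewrite <- Cmult_assoc, Cinv_l, Cmult_1_r by auto.
      rewrite ED, En4 by exact Hz. simpl INR. rewrite !RtoC_plus.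
      replace (1 * a 2%nat)%C with (2 * beta * b0)%C by (rewrite <- E0; ring).
      replace ((1 + 1) * a 3%nat)%C with (2 * beta * b1 + d1 * b0)%C by (rewrite <- E1; ring).
      replace ((1 + 1 + 1) * a 4%nat)%C with (2 * beta * b2 + d1 * b1 + d2 * b0)%C
      by (rewrite <- E2; ring).
      replace ((1 + 1 + 1 + 1) * a 5%nat)%C with (2 * beta * b3 + d1 * b2 + d2 * b1 + d3 * b0)%C
      by (rewrite <- E3; ring).
      ring. }
    rewrite EN at 1. field. auto.
Qed.

(** * The extremal function *)

(** Comparison with the geometric series gives convergence; [iota] selects the sum as a total
    function. *)
Lemma cseries_of_bounded (c : nat -> C) :
  (forall n, Cmod (c n) <= 1) -> exists F, cseries_on_disc c F.
Proof.
  intro Hc.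
  exists (fun z => iota (T := C_CompleteNormedModule)
    (fun l => Cis_series (fun n => z ^ n * c n)%C l)).
  intros z Hz; apply cseries_Cpow.
  assert (X : exists l : C, Cis_series (fun n => z ^ n * c n)%C l).
  { refine (ex_series_le (K := C_AbsRing) (V := C_CompleteNormedModule) _ (fun n => Cmod z ^ n) _ _).
    - intro n. change (Cmod (z ^ n * c n) <= Cmod z ^ n).
      rewrite Cmod_mult, Cmod_pow.
      pose proof (pow_le _ n (Cmod_ge_0 z)). pose proof (Hc n). nra.
    - apply ex_series_geom. rewrite Rabs_pos_eq by apply Cmod_ge_0; exact Hz. }
  destruct X as [l Hl].
  refine (Cis_series_eq _ _ _ Hl _).
  symmetry; exact (iota_filterlim_locally (V := C_CompleteNormedModule) _ _ Hl).
Qed.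

(* Taylor coefficients of [(1 - z^3)^(- s / 3)]. *)
Fixpoint cubic_binomial (s : R) (n : nat) : R :=
  match n with
  | O => 1
  | S (S (S m)) => (INR m + s) / (INR m + 3) * cubic_binomial s m
  | _ => 0
  end.

Lemma cubic_binomial_bounded (s : R) (n : nat) : - (3) <= s <= 3 -> Rabs (cubic_binomial s n) <= 1.
Proof.
  intro Hs; revert n. fix IH 1; intros [| [| [| m]]]; simpl cubic_binomial.
  - rewrite Rabs_R1; lra.
  - rewrite Rabs_R0; lra.
  - rewrite Rabs_R0; lra.
  - rewrite Rabs_mult, <- (Rmult_1_r 1).
    apply Rmult_le_compat; [apply Rabs_pos .. | | apply IH].
    pose proof (pos_INR m).
    apply Rabs_le; split; [apply Rle_div_r | apply Rle_div_l]; lra.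
Qed.

(** Replaces the closed form [(1 - z^3)^(- s / 3)]. The recurrence [(n + 3) c(n+3) = (n + s) c(n)]
    together with [c(1) = c(2) = 0] says [F' = z^2 (z F' + s F)]. *)
Lemma cubic_binomial_ode (s : R) (F : C -> C) (z : C) :
  cseries_on_disc (fun n => RtoC (cubic_binomial s n)) F -> in_disc z ->
  ((1 - z ^ 3) * C_derive F z = s * z ^ 2 * F z)%C.
Proof.
  intros HF Hz.
  destruct (cseries_deriv _ _ HF) as [HF1 _].
  destruct (cseries_tail _ _ HF1) as [T1 [HT1 E1]].
  destruct (cseries_tail _ _ HT1) as [T2 [HT2 E2]].
  assert (ET : T2 z = (z * C_derive F z + s * F z)%C).
  { apply (cseries_unique _ z _ _ (HT2 z Hz)). apply cseries_Cpow.
    pose proof (proj1 (cseries_Cpow _ _ _) (HF z Hz)) as S0.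
    pose proof (proj1 (cseries_Cpow _ _ _) (HF1 z Hz)) as S1.
    assert (S1' : Cis_series (fun n => z ^ n * (INR n * cubic_binomial s n))%C (z * C_derive F z)%C).
    { refine (proj1 (Cis_series_tail _ _) _).
      apply (Cis_series_scal z) in S1.
      refine (Cis_series_eq _ _ _ (Cis_series_ext _ _ _ _ S1) _).
      - intro n; unfold coeffs_deriv; rewrite Cpow_S; ring.
      - simpl INR; ring. }
    refine (Cis_series_ext _ _ _ _ (Cis_series_plus _ _ _ _ S1' (Cis_series_scal s _ _ S0))).
    intro n; unfold coeffs_deriv; cbv beta.
    pose proof (pos_INR n).
    assert (E : INR (S (S (S n))) * cubic_binomial s (S (S (S n)))
                = (INR n + s) * cubic_binomial s n)
      by (rewrite !S_INR; simpl cubic_binomial; field; lra).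
    rewrite <- (RtoC_mult (INR (S (S (S n))))), E, RtoC_mult, RtoC_plus; ring. }
  assert (E : C_derive F z = (z * (z * T2 z))%C).
  { rewrite E1, E2 by exact Hz. unfold coeffs_deriv; simpl cubic_binomial. ring. }
  replace ((1 - z ^ 3) * C_derive F z)%C with (C_derive F z - z ^ 3 * C_derive F z)%C by ring.
  rewrite E at 1. rewrite ET. ring.
Qed.

(** The real part is constant along the segment from 0 to [z]; applying this to [Ci * P] as well
    settles the imaginary part. *)
Lemma cderiv_zero_const (P : C -> C) (z : C) :
  (forall w, in_disc w -> cderiv P w 0) -> in_disc z -> P z = P 0.
Proof.
  intros HP Hz.
  assert (K : forall Q, (forall w, in_disc w -> cderiv Q w 0) -> Re (Q z) = Re (Q 0)).
  { intros Q HQ.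
    cut (Re (Q (0 * fst z, 0 * snd z)) = Re (Q (1 * fst z, 1 * snd z))).
    { rewrite !Rmult_0_l, !Rmult_1_l, <- surjective_pairing; symmetry; assumption. }
    apply (eq_is_derive (V := R_NormedModule) (fun t => Re (Q (t * fst z, t * snd z))) 0 1);
      [intros t Ht | lra].
    refine (eq_rect _ (fun d => is_derive _ t d)
      (is_derive_Re_curve Q (fun t => t * fst z) (fun t => t * snd z) t (fst z) (snd z) 0 _ _ _) _ _).
    - auto_derive; [exact I | ring].
    - auto_derive; [exact I | ring].
    - apply HQ. unfold in_disc in *.
      replace (t * fst z, t * snd z) with (t * z)%C by (destruct z; unfold Cmult; simpl; f_equal; ring).
      rewrite Cmod_mult, Cmod_R, Rabs_pos_eq by lra. pose proof (Cmod_ge_0 z); nra.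
    - rewrite Cmult_0_r; reflexivity. }
  pose proof (K P HP) as K1.
  pose proof (K (fun w => Ci * P w)%C) as K2.
  assert (K3 : Re (Ci * P z)%C = Re (Ci * P 0)%C).
  { apply K2. intros w Hw. eapply cderiv_eq; [apply cderiv_scal, HP, Hw | ring]. }
  destruct (P z), (P 0); simpl in *. f_equal; lra.
Qed.

Lemma Re_half_plane (w : C) : Cmod w < 1 -> - (1 / 2) < Re (w / (1 - w))%C.
Proof.
  intro Hw.
  assert (Hsq : Re w ^ 2 + Im w ^ 2 < 1)
    by (rewrite <- Cmod2_alt; pose proof (Cmod_ge_0 w); nra).
  destruct w as [x y]; simpl in *.
  assert (Hden : 0 < (1 - x) ^ 2 + y ^ 2) by nra.
  replace (x * _ - y * _) with ((x * (1 - x) - y ^ 2) / ((1 - x) ^ 2 + y ^ 2))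
    by (field; nra).
  apply Rlt_div_r; [exact Hden | nra].
Qed.

(** For [f = z F] the differential equation gives [z f' / f = 1 + s z^3 / (1 - z^3)], with real part
    above [1 - s / 2 = alpha]. *)
Lemma cubic_starlike (alpha : R) :
  0 <= alpha < 1 ->
  exists (f : C -> C) (a : nat -> C),
    starlike alpha f /\ normalized_expansion f a /\
    Cmod (hankel3 a) = 4 * (1 - alpha) ^ 2 / 9.
Proof.
  intro Ha.
  set (s := 2 * (1 - alpha)).
  assert (Hs : 0 < s <= 2) by (unfold s; lra).
  destruct (cseries_of_bounded (fun n => RtoC (cubic_binomial s n))) as [F HF].
  { intro n; rewrite Cmod_R; apply cubic_binomial_bounded; lra. }
  (* [G] is the reciprocal of [F], introduced to show that [F] has no zeros. *)
  destruct (cseries_of_bounded (fun n => RtoC (cubic_binomial (- s) n))) as [G HG].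
  { intro n; rewrite Cmod_R; apply cubic_binomial_bounded; lra. }
  destruct (cseries_deriv _ _ HF) as [_ DF]. destruct (cseries_deriv _ _ HG) as [_ DG].
  assert (Hz3 : forall z, in_disc z -> Cmod (z ^ 3) < 1).
  { intros z Hz; rewrite Cmod_pow. unfold in_disc in Hz. pose proof (Cmod_ge_0 z).
    assert (Cmod z ^ 2 < 1) by nra. simpl in *; nra. }
  assert (H1z : forall z, in_disc z -> (1 - z ^ 3 <> 0)%C).
  { intros z Hz E. pose proof (Hz3 z Hz) as K.
    replace (z ^ 3)%C with (RtoC 1) in K by (rewrite <- (Cplus_0_l (z ^ 3)), <- E; ring).
    rewrite Cmod_1 in K; lra. }
  assert (Hprod : forall z, in_disc z -> (F z * G z = 1)%C).
  { intros z Hz.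
    rewrite (cderiv_zero_const (fun w => F w * G w)%C z); [| | exact Hz].
    - rewrite (cseries_at_0 _ _ HF), (cseries_at_0 _ _ HG). simpl; ring.
    - intros w Hw. eapply cderiv_eq; [exact (cderiv_mult _ _ w _ _ (DF w Hw) (DG w Hw)) |].
      pose proof (cubic_binomial_ode s F w HF Hw) as OF.
      pose proof (cubic_binomial_ode (- s) G w HG Hw) as OG.
      replace (C_derive F w) with ((1 - w ^ 3) * C_derive F w / (1 - w ^ 3))%C by (field; auto).
      replace (C_derive G w) with ((1 - w ^ 3) * C_derive G w / (1 - w ^ 3))%C by (field; auto).
      rewrite OF, OG, RtoC_opp. field; auto. }
  assert (F_nz : forall z, in_disc z -> F z <> 0).
  { intros z Hz E. specialize (Hprod z Hz). rewrite E, Cmult_0_l in Hprod.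
    apply RtoC_inj in Hprod; lra. }
  set (a := fun n => match n with O => RtoC 0 | S m => RtoC (cubic_binomial s m) end).
  assert (Df : forall z, in_disc z -> cderiv (fun w => w * F w)%C z (F z + z * C_derive F z)%C).
  { intros z Hz. eapply cderiv_eq; [exact (cderiv_mult _ _ z _ _ (cderiv_id z) (DF z Hz)) |].
    cbv beta; ring. }
  assert (Ha' : normalized_expansion (fun z => z * F z)%C a).
  { split; [reflexivity | split; [reflexivity |]]. intros z Hz.
    change (cseries a z (z * F z)%C). apply cseries_Cpow.
    refine (proj1 (Cis_series_tail _ _) _).
    pose proof (Cis_series_scal z _ _ (proj1 (cseries_Cpow _ _ _) (HF z Hz))) as S1.
    refine (Cis_series_eq _ _ _ (Cis_series_ext _ _ _ _ S1) _).
    - intro n; unfold a; rewrite Cpow_S; ring.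
    - unfold a; ring. }
  exists (fun z => z * F z)%C, a; split; [| split; [exact Ha' |]].
  - split; [split; [| exists a; exact Ha'] | split].
    + intros z Hz. eexists; apply is_derive_cderiv, Df, Hz.
    + intros z Hz Hz0. apply Cmult_neq_0; auto.
    + intros z Hz. unfold starlike_quotient.
      destruct (Ceq_dec z 0) as [Hz0 | Hz0]; [simpl; lra |].
      rewrite (cderiv_unique _ _ _ (Df z Hz)).
      pose proof (cubic_binomial_ode s F z HF Hz) as OF.
      replace (C_derive F z) with ((1 - z ^ 3) * C_derive F z / (1 - z ^ 3))%C by (field; auto).
      rewrite OF.
      replace (z * (F z + z * (s * z ^ 2 * F z / (1 - z ^ 3))) / (z * F z))%C
        with (1 + s * (z ^ 3 / (1 - z ^ 3)))%C by (field; auto).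
      pose proof (Re_half_plane _ (Hz3 z Hz)) as HR.
      replace (Re _) with (1 + s * Re (z ^ 3 / (1 - z ^ 3))%C)
        by (rewrite <- Re_RtoC_mult; reflexivity).
      unfold s in *; nra.
  - rewrite hankel3E. unfold a; simpl cubic_binomial.
    (* Among [a 2], ..., [a 5] only [a 4 = s / 3] is nonzero, so the determinant is [- (a 4)^2]. *)
    replace (_ - _ + _)%C with (- RtoC (s / 3) ^ 2)%C.
    + rewrite Cmod_opp, Cmod_pow, Cmod_R, Rabs_pos_eq by lra. unfold s; field.
    + simpl INR. replace ((0 + s) / (0 + 3) * 1) with (s / 3) by field. rewrite Rmult_0_r. ring.
Qed.

Theorem theorem2p1 (alpha : R) (halpha : (0 <= alpha <= 1 / 6) \/ alpha = 1 / 2) :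
  (forall (f : C -> C) (a : nat -> C),
     starlike alpha f -> normalized_expansion f a ->
     Cmod (hankel3 a) <= 4 * (1 - alpha) ^ 2 / 9) /\
  (exists (f : C -> C) (a : nat -> C),
     starlike alpha f /\ normalized_expansion f a /\
     Cmod (hankel3 a) = 4 * (1 - alpha) ^ 2 / 9).
Proof.
  split; [intros f a Hf Ha | apply cubic_starlike; lra].
  destruct (starlike_schur alpha f a ltac:(lra) Hf Ha)
    as [b0 [b1 [b2 [b3 [Hc [E2 [E3 [E4 E5]]]]]]]].
  apply (hankel3_bound (1 - alpha) a b0 b1 b2 b3); auto; lra.
Qed.
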